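(* Consider the symmetric game with payoff functions $f,g,h$ and suppose $f=h$. Let $V:E\to\mathbb{R}$ be given by $$V(x):=\sup_{\tau\in\mathcal{T}_1}\mathbb{E}_x[\alpha^\tau f(X_\tau)],\quad x\in E.$$ Choose a measurable function $p:E\to[0,1]$ so that \begin{itemize} \item[(i)] $\alpha\Pi V(x)=f(x),\ g(x)=f(x)\Rightarrow p(x)\in[0,1]$, \item[(ii)] $\alpha\Pi V(x)=f(x),\ g(x)\ne f(x)\Rightarrow p(x)=0$, \item[(iii)] $\alpha\Pi V(x)<f(x),\ g(x)>f(x)\Rightarrow p(x)=\dfrac{f(x)-\alpha\Pi V(x)}{g(x)-\alpha\Pi V(x)}$, \item[(iv)] $\alpha\Pi V(x)<f(x),\ g(x)\le f(x)\Rightarrow p(x)=1$, \item[(v)] $\alpha\Pi V(x)>f(x)\Rightarrow p(x)=0$. \end{itemize} Then $(p^{(1)},p^{(2)})$ with $p^{(1)}=p^{(2)}=p$ is a (symmetric) global Markovian equilibrium with values $V^{(1)}=V^{(2)}=V$.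
   Context: Setting. $X=(X_n)_{n\in\mathbb{N}_0}$ is a homogeneous Markov process with (measurable) state space $E$ and Markov kernel $\Pi$; under $\mathbb{P}_x$ (expectation $\mathbb{E}_x$) it starts at $X_0=x\in E$. Write $\Pi u(x)=\int_E u(y)\,\Pi(x,dy)$. The discount factor $\alpha\in(0,1)$ is constant and $f,g,h:E\to\mathbb{R}$ are measurable. The probability space supports two sequences $(\xi^{(i)}_n)_{n\in\mathbb{N}_0}$, $i=1,2$, of iid uniform $(0,1)$ random variables, independent of $X$ and of each other. Killed process. $\tilde X$ is the process $X$ killed at each time step with probability $1-\alpha$ (independently of everything else): $\tilde X_n=X_n$ for $n\le T$ and $\tilde X_n=K$ for $n>T$, where $\mathbb{P}(T=k)=(1-\alpha)\alpha^k$, $k\in\mathbb{N}_0$, and $K$ is an absorbing cemetery state at which all functions take the value $0$. Standing integrability assumption. Under every $\mathbb{P}_x$: $\sup_{n}|f(\tilde X_n)|,\ \sup_{n}|g(\tilde X_n)|,\ \sup_{n}|h(\tilde X_n)|\in L^1$. Stopping times. $\mathcal{T}_i$ is the set of ($\mathbb{N}_0\cup\{\infty\}$-valued) stopping times with respect to the filtration $\sigma(X_0,\dots,X_n,\xi^{(i)}_0,\dots,\xi^{(i)}_n)$, $n\in\mathbb{N}_0$; $\alpha^\tau f(X_\tau)$ is read as $0$ on $\{\tau=\infty\}$. For measurable $p^{(i)}:E\to[0,1]$, let $\tau^{p^{(i)}}=\inf\{n\in\mathbb{N}_0:\ p^{(i)}(X_n)\ge\xi^{(i)}_n\}$ ($\inf\emptyset=\infty$),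 the Markovian randomized stopping time of player $i$ identified with $p^{(i)}$. Symmetric game. Both players have the same payoff functions $f,g,h$: for $\tau_1\in\mathcal{T}_1,\tau_2\in\mathcal{T}_2$ and $i,j\in\{1,2\}$, $j\ne i$, player $i$ maximizes $$J_i(x;\tau_1,\tau_2)=\mathbb{E}_x\big[\alpha^{\tau_i}f(X_{\tau_i})\mathbb{I}_{\{\tau_i<\tau_j\}}+\alpha^{\tau_j}g(X_{\tau_j})\mathbb{I}_{\{\tau_j<\tau_i\}}+\alpha^{\tau_i}h(X_{\tau_i})\mathbb{I}_{\{\tau_i=\tau_j<\infty\}}\big].$$ $(p^{(1)},p^{(2)})$ is a global Markovian (randomized) equilibrium if for all $x\in E$: $J_1(x;\tau^{p^{(1)}},\tau^{p^{(2)}})=\sup_{\tau_1\in\mathcal{T}_1}J_1(x;\tau_1,\tau^{p^{(2)}})$ and $J_2(x;\tau^{p^{(1)}},\tau^{p^{(2)}})=\sup_{\tau_2\in\mathcal{T}_2}J_2(x;\tau^{p^{(1)}},\tau_2)$. Its values are $V^{(i)}(x)=J_i(x;\tau^{p^{(1)}},\tau^{p^{(2)}})$, $i=1,2$. It is symmetric if $p^{(1)}=p^{(2)}$. *)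

(* Defs.v *)
From HB Require Import structures.
From mathcomp Require Import all_boot all_order all_algebra.
From mathcomp Require Import all_classical all_reals all_analysis.

Set Implicit Arguments.
Unset Strict Implicit.
Unset Printing Implicit Defensive.

Import Order.TTheory GRing.Theory Num.Theory.
Import numFieldNormedType.Exports.

Local Open Scope classical_set_scope.
Local Open Scope ring_scope.

(* Times in N_0 \cup {oo} are elements of [option nat], with [None] for oo. *)
Definition time_lt (s t : option nat) : bool :=
  match s, t with
  | Some m, Some n => (m < n)%N
  | Some _, None => true
  | None, _ => false
  end.

Definition time_le (s : option nat) (n : nat) : bool :=
  if s is Some m then (m <= n)%N else false.

Section sigma_algebras.
Context (dO : measure_display) (Omega : measurableType dO).

Definition sigma_of (dT : measure_display) (T : measurableType dT)
    (I : set nat) (Y : nat -> Omega -> T) : set (set Omega) :=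
  <<s \bigcup_(k in I) preimage_set_system setT (Y k) measurable >>.

Definition sigma_rv (dT : measure_display) (T : measurableType dT)
    (Y : Omega -> T) : set (set Omega) :=
  preimage_set_system setT Y measurable.

Definition player_filtration (dE : measure_display) (E : measurableType dE)
    (R : realType) (X : nat -> Omega -> E) (xi : nat -> Omega -> R) (n : nat) :
    set (set Omega) :=
  <<s \bigcup_(k in `I_n.+1)
        (preimage_set_system setT (X k) measurable `|`
         preimage_set_system setT (xi k) measurable) >>.

Definition stopping_time (F : nat -> set (set Omega)) :
    set (Omega -> option nat) :=
  [set tau | forall n, F n [set w | time_le (tau w) n]].

End sigma_algebras.

Section setting.
Context (R : realType) (dE : measure_display) (E : measurableType dE)
        (dO : measure_display) (Omega : measurableType dO).
Local Open Scope ereal_scope.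

(* The third clause says that Pi (X n) B is a version of
   P(X_{n+1} \in B | X_0, ..., X_n). *)
Definition markov_process (Pi : R.-pker E ~> E) (P : probability Omega R)
    (X : nat -> Omega -> E) (x : E) : Prop :=
  [/\ forall n, measurable_fun setT (X n),
      forall B, measurable B -> P (X 0%N @^-1` B) = \d_x B
    & forall n A B, sigma_of `I_n.+1 X A -> measurable B ->
        P (A `&` X n.+1 @^-1` B) = \int[P]_(w in A) Pi (X n w) B].

Definition iid_uniform (P : probability Omega R) (xi : nat -> Omega -> R) :
    Prop :=
  [/\ forall n, measurable_fun setT (xi n),
      forall n (B : set R), measurable B ->
        P (xi n @^-1` B) = uniform_prob (@ltr01 R) B
    & forall (J : seq nat) (B : nat -> set R), uniq J ->
        (forall k, measurable (B k)) ->
        P (\bigcap_(k in [set` J]) (xi k @^-1` B k)) =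
        \prod_(k <- J) P (xi k @^-1` B k)].

Definition geometric_time (alpha : R) (P : probability Omega R)
    (T : Omega -> nat) : Prop :=
  measurable_fun setT T /\
  forall k, P (T @^-1` [set k]) = ((1 - alpha) * alpha ^+ k)%:E.

(* Mutual independence: as all four sigma-algebras contain the whole space,
   the product rule for subfamilies is included. *)
Definition independent4 (P : probability Omega R)
    (G1 G2 G3 G4 : set (set Omega)) : Prop :=
  forall A1 A2 A3 A4, G1 A1 -> G2 A2 -> G3 A3 -> G4 A4 ->
    P (A1 `&` A2 `&` A3 `&` A4) = P A1 * P A2 * P A3 * P A4.

(* T is the last time at which the killed process is still alive. *)
Definition game_setting (Pi : R.-pker E ~> E) (alpha : R)
    (P : E -> probability Omega R) (X : nat -> Omega -> E)
    (xi1 xi2 : nat -> Omega -> R) (T : Omega -> nat) : Prop :=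
  forall x,
  [/\ markov_process Pi (P x) X x,
      iid_uniform (P x) xi1,
      iid_uniform (P x) xi2,
      geometric_time alpha (P x) T
    & independent4 (P x) (sigma_of setT X)
        (sigma_of setT xi1) (sigma_of setT xi2) (sigma_rv T)].

(* [None] is the cemetery state. *)
Definition killed (X : nat -> Omega -> E) (T : Omega -> nat) (n : nat)
    (w : Omega) : option E :=
  if (n <= T w)%N then Some (X n w) else None.

Definition on_cemetery (u : E -> R) (y : option E) : R :=
  if y is Some z then u z else 0%R.

Definition sup_killed_integrable (P : E -> probability Omega R)
    (X : nat -> Omega -> E) (T : Omega -> nat) (u : E -> R) : Prop :=
  forall x, (P x).-integrable setT
    (fun w => ereal_sup (range (fun n =>
       `|on_cemetery u (killed X T n w)|%:E))).

End setting.

Section game.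
Context (R : realType) (dE : measure_display) (E : measurableType dE)
        (dO : measure_display) (Omega : measurableType dO).
Variables (alpha : R) (P : E -> probability Omega R) (X : nat -> Omega -> E).

Definition discounted (u : E -> R) (tau : Omega -> option nat) (w : Omega) : R :=
  if tau w is Some n then alpha ^+ n * u (X n w) else 0.

(* Payoff of a player who uses [tau] against [sigma]. On {tau = sigma = oo}
   the last summand is 0 because [discounted] vanishes there. *)
Definition payoff (f g h : E -> R) (tau sigma : Omega -> option nat)
    (w : Omega) : R :=
  discounted f tau w * (time_lt (tau w) (sigma w))%:R
  + discounted g sigma w * (time_lt (sigma w) (tau w))%:R
  + discounted h tau w * (tau w == sigma w)%:R.

Definition J1 (f g h : E -> R) (x : E) (tau1 tau2 : Omega -> option nat) :
  \bar R := ('E_(P x)[payoff f g h tau1 tau2])%E.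

Definition J2 (f g h : E -> R) (x : E) (tau1 tau2 : Omega -> option nat) :
  \bar R := ('E_(P x)[payoff f g h tau2 tau1])%E.

(* inf {n | p (X n) >= xi n}, with inf of the empty set equal to oo. *)
Definition markov_time (xi : nat -> Omega -> R) (p : E -> R) (w : Omega) :
    option nat :=
  match pselect (exists n, xi n w <= p (X n w)) with
  | left ex => Some (ex_minn ex)
  | right _ => None
  end.

Definition global_markov_equilibrium (xi1 xi2 : nat -> Omega -> R)
    (f g h : E -> R) (p1 p2 : E -> R) : Prop :=
  let T1 := stopping_time (player_filtration X xi1) in
  let T2 := stopping_time (player_filtration X xi2) in
  let t1 := markov_time xi1 p1 in
  let t2 := markov_time xi2 p2 in
  forall x,
    J1 f g h x t1 t2 = ereal_sup [set J1 f g h x tau t2 | tau in T1] /\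
    J2 f g h x t1 t2 = ereal_sup [set J2 f g h x t1 tau | tau in T2].

(* The supremum is finite under the integrability assumption on f. *)
Definition stopping_value (xi1 : nat -> Omega -> R) (f : E -> R) (x : E) : R :=
  fine (ereal_sup [set ('E_(P x)[discounted f tau])%E |
    tau in stopping_time (player_filtration X xi1)]).

End game.

Definition kernel_op (R : realType) (dE : measure_display)
    (E : measurableType dE) (Pi : R.-pker E ~> E) (u : E -> R) (x : E) : R :=
  \int[Pi x]_y u y.

(* Main.v *)
Require Import Defs.
From HB Require Import structures.
From mathcomp Require Import all_boot all_order all_algebra.
From mathcomp Require Import all_classical all_reals all_analysis.
From mathcomp Require Import measurable_realfun giry.
From mathcomp Require Import ring lra.

(** Write U for the solution of the optimal stopping equation
    U = max (f, alpha Pi U).  The numbers p(x) are chosen so that an opponent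
    who stops with probability p(x) in state x makes the game one step long
    worth exactly U(x): the responding player either stops and gets f(x), also
    when the opponent stops at the same time because f = h, or goes on and gets
    W(x) = p(x) g(x) + (1 - p(x)) alpha Pi U(x) on average.  Going through the
    cases (i)-(v) gives three facts:
    - if p(x) > 0 then f(x) = U(x), so a player who stops loses nothing;
    - if p(x) < 1 then W(x) = U(x), so a player who goes on loses nothing (in
      case (iii) this equation is what defines p);
    - W(x) <= U(x) in every case, as g(x) <= f(x) wherever p(x) = 1.

    Let the opponent play the Markovian time of p and let the other player use
    a stopping time tau.  Consider the process equal to the payoff already
    collected, plus alpha^n U(X_n) as long as nobody has stopped.  Since
    f <= U and W <= U, its expectation decreases for every tau, and if tau is
    the Markovian time of p it is constant; it starts at U(x).  The
    expectation of alpha^n U(X_n) tends to 0, so letting n grow shows that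
    every tau earns at most U(x) and that p against itself earns U(x)
    ([verification_le], [verification_eq]).  The roles of the players are
    interchangeable, which gives both equilibrium conditions.

    It remains to relate U to the stopping value V.  Against an opponent who
    never stops (p = 0) the game is the optimal stopping problem of f, so V = U
    is another instance of the verification argument, the optimal player
    stopping where U = f ([stopping_value_bellman]).

    Three analytic facts support this.
    - One step of the game ([markov_past], [past_indep]): given X up to time n,
      all draws of one player and the earlier draws of the other, the next draw
      is uniform, and given X up to time n and all draws, X_{n+1} has law
      Pi(X_n).  A pi-lambda argument derives both from the product rule for
      events, and Fubini's theorem turns stopping when the draw is at most
      p(X_n) into stopping with weight p(X_n) ([randomized_stop]).
    - Transversality ([discounted_envelope]): integrating the killing time T
      out of the supremum of |f| along the killed process yields
      Z_n = \sum_(k >= n) (1 - alpha) alpha^k max_(m <= k) |f(X_m)|, which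
      dominates alpha^n |f(X_n)|, decreases in n, is integrable and has
      expectations tending to 0.  By induction on the horizon it also controls
      the expectation of alpha^n U(X_n) ([value_envelope]).
    - Existence of U ([bellman_solution_exists]): value iteration from 0
      converges monotonically ([bellman_equation]), and the envelope makes the
      limit finite. *)

Set Implicit Arguments.
Unset Strict Implicit.
Unset Printing Implicit Defensive.

Import Order.TTheory GRing.Theory Num.Theory.
Import numFieldNormedType.Exports.

Local Open Scope classical_set_scope.
Local Open Scope ring_scope.

(** * Integrals over sub-sigma-algebras and independence *)

Section measure_giry.
Context {R : realType} {d : measure_display} {T : measurableType d}.
Local Open Scope ereal_scope.
Variable m : {measure set T -> \bar R}.

(** The proof that the mass is at most 1 is an argument so that the structure
    of sub-probability can be attached to the measure; it then becomes a point
    of the Giry monad, whose bind operation carries the disintegration used for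
    the Markov property. *)
Definition total_le1_measure (m1 : m setT <= 1) : set T -> \bar R := m.
Variable m1 : m setT <= 1.
Local Notation m' := (total_le1_measure m1).

Let m'0 : m' set0 = 0. Proof. exact: measure0. Qed.
Let m'_ge0 A : 0 <= m' A. Proof. exact: measure_ge0. Qed.
Let m'_add : semi_sigma_additive m'.
Proof. exact: measure_semi_sigma_additive. Qed.

HB.instance Definition _ := isMeasure.Build _ _ _ m' m'0 m'_ge0 m'_add.
HB.instance Definition _ := Measure_isSubProbability.Build _ _ _ m' m1.

Definition measure_giry : giry T R := m'.

End measure_giry.

(** The domain is retyped by its coarser sigma-algebra, so that the theory of
    measurable functions applies as it stands. *)
Definition measurable_wrt {d d' : measure_display} {T : measurableType d}
    {T' : sigmaRingType d'} (G : set (set T)) (F : T -> T') :=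
  measurable_fun setT (F : g_sigma_algebraType G -> T').

Lemma measurable_wrt_comp {d d1 d2 : measure_display} {T : measurableType d}
    {T1 : measurableType d1} {T2 : sigmaRingType d2} (G : set (set T))
    (v : T1 -> T2) (Y : T -> T1) : measurable_fun setT v ->
  measurable_wrt G Y -> measurable_wrt G (v \o Y).
Proof.
rewrite /measurable_wrt => mv mY _ B mB; rewrite setTI.
have := mY measurableT _ (mv measurableT B mB).
by rewrite !setTI.
Qed.

Lemma measurable_wrt_EFin {R : realType} {d : measure_display}
    {T : measurableType d} (G : set (set T)) (F : T -> R) :
  measurable_wrt G F -> measurable_wrt G (fun w => (F w)%:E).
Proof. by rewrite /measurable_wrt => mF; exact/measurable_EFinP. Qed.

Section sub_sigma_algebra_integrals.
Context {R : realType} {d : measure_display} {T : measurableType d}.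
Local Open Scope ereal_scope.
Implicit Types (G : set (set T)) (F : T -> \bar R).

Lemma sub_measurable_id G : <<s G >> `<=` d.-measurable ->
  measurable_fun setT (id : T -> g_sigma_algebraType G).
Proof. by move=> sG _ B mB; rewrite setTI; exact: sG. Qed.

(** Both integrals are integrals of the same function against the images of
    the measures under the identity map onto the coarser space, where these
    images coincide. *)
Lemma eq_integral_sub_sigma_algebra G (m1 m2 : {measure set T -> \bar R}) F :
  <<s G >> `<=` d.-measurable ->
  measurable_wrt G F ->
  (forall x, 0 <= F x) ->
  (forall A, <<s G >> A -> m1 A = m2 A) ->
  \int[m1]_x F x = \int[m2]_x F x.
Proof.
move=> sG mF F0 m12; have mid := sub_measurable_id sG.
have push (m : {measure set T -> \bar R}) :
    \int[m]_x F x = \int[pushforward m (id : T -> g_sigma_algebraType G)]_x F x.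
  by rewrite (@ge0_integral_pushforward _ _ T (g_sigma_algebraType G)
    R id mid m setT F).
rewrite !push; apply: eq_measure_integral => A mA _.
exact: m12.
Qed.

Lemma integral_mrestr (m : {measure set T -> \bar R}) D (mD : measurable D) F :
  measurable_fun setT F -> (forall x, 0 <= F x) ->
  \int[mrestr m mD]_x F x = \int[m]_(x in D) F x.
Proof.
move=> mF F0.
have mCD : mrestr m mD (~` D) = 0 by rewrite /mrestr setICl measure0.
rewrite (ge0_negligible_integral _ _ _ _ mCD)//; last exact: measurableC.
rewrite setTD setCK; apply: eq_measure_integral => A mA AD.
by rewrite /= /mrestr setIidl.
Qed.

(** The trace of [P] on [D] and the multiple [P D] of [P] agree on
    the sigma-algebra generated by [G]. *)
Lemma integral_indep G (P : probability T R) D F :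
  <<s G >> `<=` d.-measurable -> measurable D ->
  (forall A, <<s G >> A -> P (A `&` D) = P A * P D) ->
  measurable_wrt G F ->
  (forall x, 0 <= F x) ->
  \int[P]_(x in D) F x = P D * \int[P]_x F x.
Proof.
move=> sG mD ind mF F0.
have mF' : measurable_fun setT F.
  by move=> _ B mB; apply: sG; exact: mF.
have PD : (fine (P D))%:E = P D by rewrite fineK// fin_num_measure.
have PD0 : (0 <= fine (P D))%R by rewrite fine_ge0.
rewrite -(@integral_mrestr P D mD)// -PD.
rewrite -(@ge0_integral_mscale _ _ _ P _ measurableT (NngNum PD0))//.
apply: (@eq_integral_sub_sigma_algebra G) => // A GA.
by rewrite /= /mrestr /mscale ind//= PD muleC.
Qed.

Lemma uniform_prob_le (c : R) : (0 <= c <= 1)%R ->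
  uniform_prob (@ltr01 R) [set y | (y <= c)%R] = c%:E.
Proof.
move=> /andP[c0 c1].
have -> : [set y | (y <= c)%R] = `]-oo, c]%classic :> set R.
  by apply/seteqP; split=> y /=; rewrite in_itv.
rewrite /uniform_prob integral_uniform_pdf.
have -> : `]-oo, c]%classic `&` `[0%R, 1%R]%classic = `[0%R, c]%classic :> set R.
  apply/seteqP; split=> y /=; rewrite !in_itv/=.
    by move=> [-> /andP[-> _]].
  by move=> /andP[-> yc]; rewrite yc (le_trans yc c1).
rewrite (eq_integral (cst 1)); last first.
  move=> y; rewrite inE/= in_itv/= => /andP[y0 yc].
  by rewrite /uniform_pdf y0 (le_trans yc c1) subr0 invr1.
rewrite integral_cst//= lebesgue_measure_itv/= lte_fin mul1e.
by case: ltgtP c0 => // [_ _|<- _]; rewrite ?sube0.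
Qed.

(** Freezing: as [xi] is independent of [G], the joint law of the identity into
    the coarser space and of [xi] is a product measure, and Fubini's theorem
    integrates [xi] out first. *)
Lemma integral_indep_pair G (P : probability T R)
    (d' : measure_display) (T' : measurableType d') (U : probability T' R)
    (xi : T -> T') (H : T * T' -> \bar R) :
  <<s G >> `<=` d.-measurable ->
  measurable_fun setT xi ->
  (forall A B, <<s G >> A -> measurable B -> P (A `&` xi @^-1` B) = P A * U B) ->
  measurable_fun setT (H : g_sigma_algebraType G * T' -> \bar R) ->
  (forall z, 0 <= H z) ->
  \int[P]_w H (w, xi w) = \int[P]_w \int[U]_y H (w, y).
Proof.
move=> sG mxi ind mH H0.
pose TG : measurableType _ := g_sigma_algebraType G.
have mid := sub_measurable_id sG.
pose idm_mixin := isMeasurableFun.Build _ _ T TG id mid.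
pose idm : {mfun T >-> TG} := HB.pack (id : T -> TG) idm_mixin.
pose Q : probability TG R := distribution P idm.
pose phi (w : T) : TG * T' := (w, xi w).
have mphi : measurable_fun setT phi by exact: measurable_fun_pair.
transitivity (\int[P]_w (H \o phi) w); first by [].
rewrite -(@ge0_integral_pushforward _ _ _ _ R phi mphi P setT H)//.
transitivity (\int[Q \x U]_z H z).
  apply: (@eq_measure_integral _ (TG * T')%type R setT) => A mA _; apply/esym.
  by apply: product_measure_unique.
rewrite fubini_tonelli1//= /fubini_F.
rewrite (@ge0_integral_pushforward _ _ T TG R id mid P)//.
  exact: measurable_fun_fubini_tonelli_F.
by move=> x _; exact: integral_ge0.
Qed.

(** Randomization is replaced by a weight: a uniform draw lies below an already
    known level [Z] with conditional probability [Z]. *)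
Lemma integral_indep_uniform G (P : probability T R) (xi Z : T -> R) F :
  <<s G >> `<=` d.-measurable ->
  measurable_fun setT xi ->
  (forall A B, <<s G >> A -> measurable B ->
    P (A `&` xi @^-1` B) = P A * uniform_prob (@ltr01 R) B) ->
  measurable_wrt G Z -> (forall x, (0 <= Z x <= 1)%R) ->
  measurable_wrt G F -> (forall x, 0 <= F x) ->
  \int[P]_(w in [set w | (xi w <= Z w)%R]) F w = \int[P]_w ((Z w)%:E * F w).
Proof.
move=> sG mxi ind mZ Z01 mF F0.
pose TG : measurableType _ := g_sigma_algebraType G.
pose U : probability _ R := uniform_prob (@ltr01 R).
pose H (z : TG * measurableTypeR R) : \bar R :=
  if (z.2 <= Z z.1 :> R)%R then F z.1 else 0.
have mH : measurable_fun setT H.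
  apply: measurable_fun_ifT.
  - apply: measurable_fun_ler; last exact: (measurableT_comp mZ).
    exact: measurable_snd.
  - exact: (measurableT_comp mF).
  - exact: measurable_cst.
have H0 z : 0 <= H z by rewrite /H; case: ifP.
transitivity (\int[P]_w H (w, xi w)).
  rewrite integral_mkcond; apply: eq_integral => w _.
  rewrite patchE /H/=; case: ifPn; rewrite ?inE ?notin_setE/=.
    by move=> ->.
  by move=> /negP/negbTE ->.
rewrite (@integral_indep_pair G P _ _ U xi H)//.
apply: eq_integral => x _; rewrite /H/=.
transitivity (\int[U]_y (F x * (\1_[set y | (y <= Z x)%R] y)%:E)).
  apply: eq_integral => y _; rewrite indicE.
  case: ifPn => [h|/negP h]; first by rewrite mem_set ?mule1.
  by rewrite memNset ?mule0.
have mle : measurable [set y | (y <= Z x)%R].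
  have -> : [set y | (y <= Z x)%R] = `]-oo, Z x]%classic :> set R.
    by apply/seteqP; split=> y /=; rewrite in_itv.
  exact: measurable_itv.
rewrite ge0_integralZl//; last exact/measurable_EFinP/measurable_indic.
rewrite integral_indic// setIT muleC; congr (_ * _).
exact: uniform_prob_le.
Qed.

End sub_sigma_algebra_integrals.
(** * The past of the game and the laws of its next step *)

Section generated_sigma_algebras.
Context {R : realType} {dO : measure_display} {Omega : measurableType dO}.
Local Open Scope ereal_scope.

Definition rectangles (G1 G2 G3 : set (set Omega)) : set (set Omega) :=
  [set A | exists A1 A2 A3,
    [/\ G1 A1, G2 A2, G3 A3 & A = A1 `&` A2 `&` A3]].

Lemma rectangles_setI G1 G2 G3 : setI_closed G1 -> setI_closed G2 ->
  setI_closed G3 -> setI_closed (rectangles G1 G2 G3).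
Proof.
move=> I1 I2 I3 _ _ [A1 [A2 [A3 [? ? ? ->]]]] [B1 [B2 [B3 [? ? ? ->]]]].
exists (A1 `&` B1), (A2 `&` B2), (A3 `&` B3); split; [exact: I1|exact: I2|exact: I3|].
by rewrite setIACA; congr (_ `&` _); rewrite setIACA.
Qed.

Lemma rectangles_sub G1 G2 G3 : G1 `<=` measurable -> G2 `<=` measurable ->
  G3 `<=` measurable -> rectangles G1 G2 G3 `<=` measurable.
Proof.
move=> s1 s2 s3 _ [A1 [A2 [A3 [? ? ? ->]]]].
by apply: measurableI; [apply: measurableI; [exact: s1|exact: s2]|exact: s3].
Qed.

Lemma gsigma_sub (G : set (set Omega)) :
  G `<=` measurable -> <<s G >> `<=` measurable.
Proof. by apply: smallest_sub; exact: sigma_algebra_measurable. Qed.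

(** Dynkin's pi-lambda theorem for measures of finite total mass. *)
Lemma measure_unique_setT (G : set (set Omega))
    (m1 m2 : {measure set Omega -> \bar R}) :
  G `<=` measurable -> setI_closed G -> G setT -> m1 setT < +oo ->
  (forall A, G A -> m1 A = m2 A) -> forall A, <<s G >> A -> m1 A = m2 A.
Proof.
move=> sG GI GT fin m12; apply: (@g_sigma_algebra_measure_unique _ _ _ G sG (fun=> setT)) => //.
by rewrite bigcup_const.
Qed.

Section sigma_of_facts.
Context (dT : measure_display) (T : measurableType dT) (Y : nat -> Omega -> T).

Lemma sigma_of_setI I : setI_closed (sigma_of I Y).
Proof. by move=> A B; exact: (@measurableI _ (g_sigma_algebraType _)). Qed.

Lemma sigma_ofT I : sigma_of I Y setT.
Proof. exact: (@measurableT _ (g_sigma_algebraType _)). Qed.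

Lemma sigma_of_measurable I : (forall n, measurable_fun setT (Y n)) ->
  sigma_of I Y `<=` measurable.
Proof. by move=> mY; apply: gsigma_sub => A [k _ [B mB <-]]; exact: mY. Qed.

Lemma sigma_of_subset I J : I `<=` J -> sigma_of I Y `<=` sigma_of J Y.
Proof. by move=> IJ; apply: sub_sigma_algebra2 => A [k /IJ Jk YA]; exists k. Qed.

Lemma sigma_of_preimage (I : set nat) k B :
  I k -> measurable B -> sigma_of I Y (Y k @^-1` B).
Proof.
by move=> Ik mB; apply: sub_sigma_algebra; exists k => //; exists B; rewrite ?setTI.
Qed.

End sigma_of_facts.

(** The pi-system describing what may be known at time [n]: the states up to
    time [n], the draws [xb] with index in [J], and all draws [xa].  The latter
    include the future ones, which is harmless because [xa] is independent of
    everything else; it lets one sigma-algebra contain every stopping time of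
    the player who draws [xa]. *)
Definition past (dE : measure_display) (E : measurableType dE)
    (X : nat -> Omega -> E) (xa xb : nat -> Omega -> R) (n : nat) (J : set nat) :=
  rectangles (sigma_of `I_n.+1 X) (sigma_of setT xa) (sigma_of J xb).

Section past_facts.
Context (dE : measure_display) (E : measurableType dE).
Variables (X : nat -> Omega -> E) (xa xb : nat -> Omega -> R) (n : nat).

Lemma past_setI J : setI_closed (past X xa xb n J).
Proof. by apply: rectangles_setI; exact: sigma_of_setI. Qed.

Lemma pastT J : past X xa xb n J setT.
Proof.
by exists setT, setT, setT; split; rewrite ?setIT//; exact: sigma_ofT.
Qed.

Lemma past_measurable J : (forall k, measurable_fun setT (X k)) ->
  (forall k, measurable_fun setT (xa k)) ->
  (forall k, measurable_fun setT (xb k)) ->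
  past X xa xb n J `<=` measurable.
Proof. by move=> mX ma mb; apply: rectangles_sub; exact: sigma_of_measurable. Qed.

Lemma past_X J k : (k <= n)%N -> measurable_wrt (past X xa xb n J) (X k).
Proof.
move=> kn _ B mB; rewrite setTI; apply: sub_sigma_algebra.
exists (X k @^-1` B), setT, setT; split; rewrite ?setIT//; try exact: sigma_ofT.
exact: sigma_of_preimage.
Qed.

Lemma past_xa J k B : measurable B -> <<s past X xa xb n J >> (xa k @^-1` B).
Proof.
move=> mB; apply: sub_sigma_algebra.
exists setT, (xa k @^-1` B), setT; split; rewrite ?setIT ?setTI//; try exact: sigma_ofT.
exact: sigma_of_preimage.
Qed.

Lemma past_xb J k : J k -> measurable_wrt (past X xa xb n J) (xb k).
Proof.
move=> Jk _ B mB; rewrite setTI; apply: sub_sigma_algebra.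
exists setT, setT, (xb k @^-1` B); split; rewrite ?setTI//; try exact: sigma_ofT.
exact: sigma_of_preimage.
Qed.

End past_facts.

End generated_sigma_algebras.

Lemma measurable_kernel_integral {R : realType} {dE : measure_display}
    {E : measurableType dE} (Pi : R.-pker E ~> E) (u : E -> \bar R) :
  measurable_fun setT u -> (forall y, 0 <= u y)%E ->
  measurable_fun setT (fun y => \int[Pi y]_z u z)%E.
Proof.
move=> mu u0; apply: measurable_fun_integral_kernel => // U mU.
exact: measurable_kernel.
Qed.

Section one_step_laws.
Context {R : realType} {dE : measure_display} {E : measurableType dE}
        {dO : measure_display} {Omega : measurableType dO}.
Local Open Scope ereal_scope.
Variables (Pi : R.-pker E ~> E) (P : probability Omega R)
          (X : nat -> Omega -> E) (xa xb : nat -> Omega -> R) (x : E).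
Hypothesis mkv : markov_process Pi P X x.
Hypothesis mxa : forall n, measurable_fun setT (xa n).
Hypothesis iidb : iid_uniform P xb.
Hypothesis indep : forall A1 A2 A3, sigma_of setT X A1 -> sigma_of setT xa A2 ->
  sigma_of setT xb A3 -> P (A1 `&` A2 `&` A3) = P A1 * P A2 * P A3.

Let mX n : measurable_fun setT (X n). Proof. by case: mkv. Qed.
Let mxb n : measurable_fun setT (xb n). Proof. by case: iidb. Qed.

Let sub_past n J : <<s past X xa xb n J >> `<=` measurable.
Proof. by apply: gsigma_sub; exact: past_measurable. Qed.

(** Mutual independence is given for single coordinates; the cylinders over
    the indices below [n] form a pi-system to which it applies directly. *)
Lemma iid_uniform_past n A B : sigma_of `I_n xb A -> measurable B ->
  P (A `&` xb n @^-1` B) = P A * uniform_prob (@ltr01 R) B.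
Proof.
move=> sA mB; case: iidb => _ law prodl.
pose cyl := [set A | exists C : nat -> set R, (forall k, measurable (C k)) /\
  A = \bigcap_(k in [set` iota 0 n]) (xb k @^-1` C k)].
have mpre k C : measurable C -> measurable (xb k @^-1` C).
  by move=> mC; rewrite -[X in measurable X]setTI; exact: mxb.
have cylm : cyl `<=` measurable.
  move=> _ [C [mC ->]]; apply: bigcap_measurableType => k _; exact: mpre.
have cylI : setI_closed cyl.
  move=> _ _ [C [mC ->]] [D [mD ->]]; exists (fun k => C k `&` D k).
  by split=> [k|]; [exact: measurableI|rewrite -bigcapI].
have cylT : cyl setT.
  exists (fun=> setT); split=> //; apply/seteqP; split=> // w _ k _.
have {sA}cA : <<s cyl >> A.
  move: A sA; apply: sub_sigma_algebra2 => A [k /= kn [C mC <-]].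
  exists (fun j => if j == k then C else setT); split.
    by move=> j; case: ifP.
  rewrite setTI; apply/seteqP; split=> w.
    by move=> Cw j _; rewrite /=; case: eqP => // ->.
  by move=> /(_ k); rewrite /= eqxx; apply; rewrite mem_iota.
have mB' := mpre n B mB.
have fP D : measurable D -> (fine (P D))%:E = P D.
  by move=> mD; rewrite fineK// fin_num_measure.
have PB0 : (0 <= fine (P (xb n @^-1` B)))%R by rewrite fine_ge0.
rewrite -(law n)//.
suff : mrestr P mB' A = mscale (NngNum PB0) P A.
  by rewrite /= /mrestr /mscale /= fP// => ->; rewrite muleC.
apply: (measure_unique_setT cylm cylI cylT) => //.
  by rewrite /= /mrestr setTI (le_lt_trans (probability_le1 P mB'))// ltry.
move=> _ [C [mC ->]]; rewrite /= /mrestr /mscale /= fP//.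
(* The cylinder extended by the constraint on coordinate n; the product rule
   over the indices 0, ..., n is then compared with the one below n. *)
pose C' k := if k == n then B else C k.
have C'n : C' n = B by rewrite /C' eqxx.
have mC' k : measurable (C' k) by rewrite /C'; case: ifP.
have CC' k : (k \in iota 0 n) -> C' k = C k.
  by rewrite mem_iota /= add0n /C' => kn; rewrite ltn_eqF.
have := prodl (iota 0 n.+1) C' (iota_uniq _ _) mC'.
rewrite -addn1 iotaD big_cat/= add0n big_seq1 C'n muleC.
have := prodl (iota 0 n) C' (iota_uniq _ _) mC'.
have -> : \bigcap_(k in [set` iota 0 n]) xb k @^-1` C' k =
          \bigcap_(k in [set` iota 0 n]) xb k @^-1` C k.
  by apply: eq_bigcapr => k /= /CC' ->.
move=> <- <-; congr (P _); apply/seteqP; split=> w.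
  move=> [Cw Bw] k /=; rewrite mem_cat inE => /orP[kn|/eqP ->].
    by rewrite CC'//; exact: Cw.
  by rewrite C'n.
move=> Cw; split.
  by move=> k /= kn; rewrite -(CC' k kn); apply: Cw; rewrite /= mem_cat kn.
by have := Cw n; rewrite C'n /= mem_cat inE eqxx orbT; apply.
Qed.

(** When a draw is compared with its level, it is independent of the states up
    to and including that time, of the opponent's draws and of the earlier
    draws. *)
Lemma past_indep n A B : <<s past X xa xb n `I_n >> A -> measurable B ->
  P (A `&` xb n @^-1` B) = P A * uniform_prob (@ltr01 R) B.
Proof.
move=> pA mB; case: (iidb) => _ law _.
have mB' : measurable (xb n @^-1` B).
  by rewrite -[X in measurable X]setTI; exact: mxb.
have fP D : measurable D -> (fine (P D))%:E = P D.
  by move=> mD; rewrite fineK// fin_num_measure.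
have PB0 : (0 <= fine (P (xb n @^-1` B)))%R by rewrite fine_ge0.
rewrite -(law n)//.
suff : mrestr P mB' A = mscale (NngNum PB0) P A.
  by rewrite /= /mrestr /mscale /= fP// => ->; rewrite muleC.
apply: (measure_unique_setT (@past_measurable _ _ _ _ _ X xa xb n `I_n mX mxa mxb)
  (@past_setI _ _ _ _ _ X xa xb n `I_n) (pastT X xa xb n `I_n)) => //.
  by rewrite /= /mrestr setTI (le_lt_trans (probability_le1 P mB'))// ltry.
move=> _ [A1 [A2 [A3 [s1 s2 s3 ->]]]]; rewrite /= /mrestr /mscale /= fP//.
have {}s1 := sigma_of_subset (@subsetT _ _) s1.
have s3T := sigma_of_subset (@subsetT _ _) s3.
rewrite -setIA indep//; last by apply: sigma_of_setI => //; exact: sigma_of_preimage.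
by rewrite indep// iid_uniform_past// -(law n)// muleA muleC.
Qed.

Let mPiX n B : measurable B -> measurable_fun setT (fun w => Pi (X n w) B).
Proof. by move=> mB; exact: (measurableT_comp (measurable_kernel Pi B mB) (mX n)). Qed.

(** The Markov property holds given the states alone; the draws can be added to
    the conditioning because they are independent of the whole process. *)
Lemma markov_past_set n A B : <<s past X xa xb n setT >> A -> measurable B ->
  P (A `&` X n.+1 @^-1` B) = \int[P]_(w in A) Pi (X n w) B.
Proof.
move=> pA mB.
have mB' : measurable (X n.+1 @^-1` B).
  by rewrite -[X in measurable X]setTI; exact: mX.
have mPiB := mPiX n mB.
(* Both sides are measures in A: the trace of P on the event that X_{n+1} lies
   in B, and the measure with density Pi (X n) B. *)
pose nu A := \int[P]_(w in A) Pi (X n w) B.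
have nu0 : nu set0 = 0 by exact: integral_set0.
have nu_ge0 C : 0 <= nu C by exact: integral_ge0.
have nu_add : semi_sigma_additive nu.
  exact: semi_sigma_additive_nng_induced.
pose nuM := isMeasure.Build _ _ _ nu nu0 nu_ge0 nu_add.
pose nu' : {measure set Omega -> \bar R} := HB.pack nu nuM.
rewrite -/(mrestr P mB' A) -/(nu A).
apply: (measure_unique_setT (m1 := mrestr P mB') (m2 := nu') (@past_measurable _ _ _ _ _ X xa xb n setT mX mxa mxb)
  (@past_setI _ _ _ _ _ X xa xb n setT) (pastT X xa xb n setT)) => //.
  by rewrite /= /mrestr setTI (le_lt_trans (probability_le1 P mB'))// ltry.
move=> _ [A1 [A2 [A3 [s1 s2 s3 ->]]]]; rewrite /= /mrestr /nu.
have s1T := sigma_of_subset (@subsetT _ _) s1.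
have m1 := sigma_of_measurable mX s1.
have m2 := sigma_of_measurable mxa s2.
have m3 := sigma_of_measurable mxb s3.
have m23 : measurable (A2 `&` A3) by exact: measurableI.
have P23 : P (A2 `&` A3) = P A2 * P A3.
  have := indep (@sigma_ofT _ _ _ _ X setT) s2 s3.
  by rewrite setTI probability_setT mul1e.
transitivity (P (A2 `&` A3) * \int[P]_(w in A1) Pi (X n w) B).
  case: mkv => _ _ mk; rewrite -mk// P23.
  have -> : A1 `&` A2 `&` A3 `&` X n.+1 @^-1` B =
      (A1 `&` X n.+1 @^-1` B) `&` A2 `&` A3.
    by rewrite -!setIA; congr (_ `&` _); rewrite setIA setIC.
  have sAB : sigma_of setT X (A1 `&` X n.+1 @^-1` B).
    by apply: sigma_of_setI => //; exact: sigma_of_preimage.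
  by rewrite indep// -muleA muleC.
rewrite -setIA (setIC A1) integral_mkcondr [in LHS]integral_mkcond.
apply/esym/(@integral_indep _ _ _ (\bigcup_(k in setT)
    preimage_set_system setT (X k) measurable)) => //.
- exact: sigma_of_measurable.
- move=> C sC; rewrite setIA indep// -[C in RHS]setIT -[_ `&` _ in RHS]setIT.
  by rewrite P23 muleA setIT setIT.
- apply/(@measurable_restrict _ _ (g_sigma_algebraType _)) => //.
  apply: measurable_funTS.
  apply: (@measurable_wrt_comp _ _ _ _ _ _ _ (Pi ^~ B) (X n)).
    exact: (measurable_kernel Pi B mB).
  by move=> _ C mC; rewrite setTI; exact: sigma_of_preimage.
- by move=> w; rewrite patchE; case: ifP.
Qed.

(** The law of X_{n+1} on the event [A] is the composition of [P] restricted to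
    [A] with the kernel; associativity of the Giry bind passes from sets to
    functions. *)
Lemma markov_past n A (u : E -> \bar R) : <<s past X xa xb n setT >> A ->
  measurable_fun setT u -> (forall y, 0 <= u y) ->
  \int[P]_(w in A) u (X n.+1 w) = \int[P]_(w in A) \int[Pi (X n w)]_y u y.
Proof.
move=> pA mu u0.
have mA := sub_past pA.
have Pi1 y : Pi y setT <= 1 by rewrite prob_kernel.
pose PiS y : giry E R := measure_giry (Pi1 y).
have mPi : measurable_fun setT (fun w => PiS (X n w)).
  by apply: measurable_giry_codensity => // B mB; exact: mPiX.
have subp : mrestr P mA setT <= 1 by rewrite /mrestr setTI probability_le1.
pose PA : giry Omega R := measure_giry subp.
transitivity (\int[pushforward PA (X n.+1)]_y u y).
  rewrite ge0_integral_pushforward//= integral_mrestr//.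
  exact: measurableT_comp.
transitivity (giry_int (giry_bind PA mPi) u).
  apply: eq_measure_integral => B mB _.
  rewrite /= giry_int_map//.
    rewrite /giry_int/= integral_mrestr//; last exact: mPiX.
    by rewrite -markov_past_set// /pushforward /mrestr setIC.
  exact: measurable_giry_ev.
rewrite giry_int_bind// /giry_int/= integral_mrestr//.
  exact: (measurableT_comp (measurable_kernel_integral Pi mu u0) (mX n)).
by move=> w; exact: integral_ge0.
Qed.

End one_step_laws.
(** * An integrable envelope of the discounted payoffs *)

Section envelope.
Context {R : realType} {dE : measure_display} {E : measurableType dE}
        {dO : measure_display} {Omega : measurableType dO}.
Local Open Scope ereal_scope.
Variables (alpha : R) (P : probability Omega R) (X : nat -> Omega -> E)
          (T : Omega -> nat).
Hypotheses (alpha0 : (0 < alpha)%R) (alpha1 : (alpha < 1)%R).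

Lemma geometric_tail (c : R) (n : nat) : (0 <= c)%R ->
  \sum_(n <= k <oo) ((1 - alpha) * alpha ^+ k * c)%:E = (alpha ^+ n * c)%:E.
Proof.
move=> c0; apply/cvg_lim => //.
have -> : (fun N => \sum_(n <= k < N) ((1 - alpha) * alpha ^+ k * c)%:E) =
    EFin \o (fun N => \sum_(n <= k < N) ((1 - alpha) * alpha ^+ k * c))%R.
  by apply/funext => N /=; rewrite sumEFin.
apply/cvg_EFin; first exact: nearW.
have : (fun N : nat => alpha ^+ n * c - alpha ^+ N * c)%R @ \oo --> (alpha ^+ n * c)%R.
  rewrite -[X in _ --> X]subr0 -[X in _ --> (_ - X)%R](mul0r c).
  apply: cvgB; first exact: cvg_cst.
  apply: cvgMr_tmp; apply: cvg_expr.
  by rewrite gtr0_norm.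
apply: cvg_trans; apply: near_eq_cvg; near=> N.
have nN : (n <= N)%N by near: N; exact: nbhs_infty_ge.
rewrite [RHS](eq_big_nat _ _ (F2 := fun k => - (alpha ^+ k.+1 * c) - - (alpha ^+ k * c))%R).
  by rewrite telescope_sumr// opprK addrC.
by move=> k _; rewrite exprS; ring.
Unshelve. all: by end_near. Qed.

Fixpoint running_max (v : nat -> R) (k : nat) : R :=
  if k is j.+1 then Num.max (running_max v j) (v j.+1) else v 0%N.

Lemma le_running_max v k m : (m <= k)%N -> (v m <= running_max v k)%R.
Proof.
elim: k => [|k IH]; first by rewrite leqn0 => /eqP ->.
rewrite leq_eqVlt ltnS le_max => /orP[/eqP ->|/IH ->//].
by rewrite lexx orbT.
Qed.

Lemma running_max_le v k (c : R) :
  (forall m, (m <= k)%N -> (v m <= c)%R) -> (running_max v k <= c)%R.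
Proof.
elim: k => [h|k IH h]; first exact: h.
by rewrite /= ge_max h// IH// => m mk; rewrite h// ltnW.
Qed.

(** The integrability assumption on the killed process enters only through the
    existence of such a sequence. *)
Definition tail_envelope (f : E -> R) (Z : nat -> Omega -> \bar R) :=
  [/\ forall n, measurable_fun setT (Z n),
      forall n w, (alpha ^+ n * `|f (X n w)|)%:E <= Z n w,
      forall n w, Z n.+1 w <= Z n w,
      \int[P]_w Z 0%N w < +oo
    & \int[P]_w Z n w @[n --> \oo] --> 0].

(** With M_k = max_(m <= k) |f(X_m)|, the sequence is
    Z_n = \sum_(k >= n) (1 - alpha) alpha^k M_k.  It dominates alpha^n |f(X_n)|
    because the weights from n on sum up to alpha^n.  As T is geometric and
    independent of X, the expectation of Z_0 is the sum over k of the
    expectations of M_k on {T = k}, which is at most the expectation of the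
    supremum along the killed process; the other expectations are tails of
    this convergent series. *)
Lemma discounted_envelope (f : E -> R) :
  measurable_fun setT f ->
  (forall n, measurable_fun setT (X n)) ->
  geometric_time alpha P T ->
  (forall k A, sigma_of setT X A ->
    P (A `&` T @^-1` [set k]) = P A * P (T @^-1` [set k])) ->
  P.-integrable setT (fun w => ereal_sup (range (fun n =>
       `|on_cemetery f (killed X T n w)|%:E))) ->
  exists Z, tail_envelope f Z.
Proof.
move=> mf mX [mT lawT] indT intf.
pose M k w : R := running_max (fun m => `|f (X m w)|%R) k.
have M_ge k m w : (m <= k)%N -> (`|f (X m w)| <= M k w)%R.
  by move=> mk; exact: (le_running_max (fun m => `|f (X m w)|%R)).
have M0 k w : (0 <= M k w)%R by exact: le_trans (M_ge k 0%N w _).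
pose GX := \bigcup_(k in setT) preimage_set_system setT (X k) measurable.
have sGX : <<s GX >> `<=` measurable by exact: sigma_of_measurable.
have mMX k : measurable_wrt GX (M k).
  have mfX m : measurable_wrt GX (fun w => `|f (X m w)|%R).
    apply: (@measurable_wrt_comp _ _ _ _ _ _ _ (fun y => `|f y|%R) (X m)).
      exact: measurableT_comp.
    by move=> _ C mC; rewrite setTI; exact: sigma_of_preimage.
  rewrite /M; elim: k => [|k IH]; first exact: mfX.
  exact: (measurable_maxr IH (mfX k.+1)).
have mM k : measurable_fun setT (M k).
  by move=> _ B mB; apply: sGX; exact: mMX.
pose t k w := ((1 - alpha) * alpha ^+ k * M k w)%:E.
have t0 k w : 0 <= t k w.
  by rewrite lee_fin mulr_ge0// mulr_ge0 ?exprn_ge0 ?subr_ge0// ltW.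
have mt k : measurable_fun setT (t k).
  by apply/measurable_EFinP; exact: measurable_funM.
pose Tk k := T @^-1` [set k].
have mTk k : measurable (Tk k) by rewrite /Tk -[X in measurable X]setTI; exact: mT.
have int_t k : \int[P]_w t k w = \int[P]_(w in Tk k) (M k w)%:E.
  rewrite [RHS](@integral_indep _ _ _ GX)//.
  - rewrite lawT -ge0_integralZl//.
    - exact/measurable_EFinP.
    - by move=> w _; rewrite lee_fin.
    - by rewrite lee_fin mulr_ge0 ?exprn_ge0 ?subr_ge0// ltW.
  - by move=> A sA; exact: indT.
  - exact: measurable_wrt_EFin.
  - by move=> w; rewrite lee_fin.
pose K w := ereal_sup (range (fun n => `|on_cemetery f (killed X T n w)|%:E)).
have K_ge k w : Tk k w -> (M k w)%:E <= K w.
  move=> Tkw.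
  have h m : (m <= k)%N -> (`|f (X m w)|%R)%:E <= K w.
    move=> mk; apply: ereal_sup_ubound; exists m => //.
    by rewrite /killed (Tkw : T w = k) mk.
  move: h; case: (K w) => [c| |] h; rewrite ?leey// ?lee_fin.
    by apply: running_max_le => m /h; rewrite lee_fin.
  by have := h 0%N (leq0n _).
have K0 w : 0 <= K w by apply: (le_trans _ (K_ge (T w) w _)); rewrite ?lee_fin.
have [mK Koo] := integrableP _ _ _ intf.
have sum_t : \sum_(0 <= k <oo) \int[P]_w t k w < +oo.
  apply: (@le_lt_trans _ _ (\sum_(0 <= k <oo) \int[P]_(w in Tk k) K w)).
    apply: lee_nneseries => [k _ _|k _]; first by apply: integral_ge0 => w _; exact: t0.
    rewrite int_t; apply: ge0_le_integral => //.
    - by move=> w _; rewrite lee_fin.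
    - by apply: measurable_funTS; exact/measurable_EFinP.
    - exact: measurable_funTS.
    - by move=> w; exact: K_ge.
  rewrite -ge0_integral_bigcup//.
  - apply: le_lt_trans Koo; apply: le_trans (ge0_subset_integral _ _ _ _ _ (@subsetT _ _)) _ => //.
    + exact: bigcupT_measurable.
    + apply: ge0_le_integral => //; first exact: measurableT_comp.
      by move=> w _; exact: lee_abs.
  - by apply: measurable_funTS.
  - apply/trivIsetP => i j _ _ ij; apply/seteqP; split=> // w [/= Ti Tj].
    by move: ij; rewrite -Ti -Tj eqxx.
exists (fun n w => \sum_(n <= k <oo) t k w).
have int_Z n : \int[P]_w (\sum_(n <= k <oo) t k w) = \sum_(n <= k <oo) \int[P]_w t k w.
  under eq_integral do rewrite eseries_cond eseries_mkcond.
  rewrite [RHS]eseries_cond [RHS]eseries_mkcond integral_nneseries//.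
  - apply: eq_eseriesr => k _; case: ifP => // _.
    by rewrite integral0.
  - by move=> k /=; case: (n <= k)%N => //; exact: mt.
  - by move=> k w _; case: ifP.
split.
- move=> n; under eq_fun do rewrite eseries_cond.
  by apply: ge0_emeasurable_sum => // k *; exact: t0.
- move=> n w; rewrite -geometric_tail//.
  rewrite [leLHS]eseries_cond [leLHS]eseries_mkcond [leRHS]eseries_cond [leRHS]eseries_mkcond.
  apply: lee_nneseries => [k _ _|k _]; case: ifP => //= nk.
    by rewrite lee_fin mulr_ge0// mulr_ge0 ?exprn_ge0 ?subr_ge0// ltW.
  by rewrite lee_fin ler_wpM2l ?M_ge// mulr_ge0 ?exprn_ge0 ?subr_ge0// ltW.
- move=> n w; rewrite [leLHS]eseries_cond [leLHS]eseries_mkcond [leRHS]eseries_cond [leRHS]eseries_mkcond.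
  apply: lee_nneseries => [k _ _|k _] /=; case: ifP => // nk.
    by rewrite (ltnW nk).
  by case: ifP => // _; exact: t0.
- by rewrite int_Z.
- under eq_fun do rewrite int_Z.
  by apply: nneseries_tail_cvg => // k _; apply: integral_ge0 => w _; exact: t0.
Qed.

End envelope.
(** * Value iteration *)

Section value_iteration.
Context {R : realType} {dE : measure_display} {E : measurableType dE}.
Local Open Scope ereal_scope.
Variables (Pi : R.-pker E ~> E) (alpha : R) (f : E -> R).
Hypotheses (alpha0 : (0 < alpha)%R) (mf : measurable_fun setT f).

Let a0 : 0 <= alpha%:E. Proof. by rewrite lee_fin ltW. Qed.

(** The value of stopping before time [N] or never; not stopping is worth 0,
    hence the starting value. *)
Fixpoint horizon_value (N : nat) (x : E) : \bar R :=
  if N is N'.+1 then maxe (f x)%:E (alpha%:E * \int[Pi x]_y horizon_value N' y)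
  else 0.

Lemma horizon_value_ge0 N x : 0 <= horizon_value N x.
Proof.
elim: N x => [//|N IH] x /=; rewrite le_max; apply/orP; right.
by apply: mule_ge0 => //; apply: integral_ge0.
Qed.

Lemma measurable_horizon_value N : measurable_fun setT (horizon_value N).
Proof.
elim: N => [|N IH] /=; first exact: measurable_cst.
apply: measurable_maxe; first exact/measurable_EFinP.
apply: measurable_funeM; apply: measurable_kernel_integral => //.
exact: horizon_value_ge0.
Qed.

Lemma horizon_value_le N x : horizon_value N x <= horizon_value N.+1 x.
Proof.
elim: N x => [|N IH] x; first exact: horizon_value_ge0.
rewrite /= ge_max !le_max lexx /=; apply/orP; right.
apply: lee_wpmul2l => //; apply: ge0_le_integral => //.
- by move=> y _; exact: horizon_value_ge0.
- exact: measurable_horizon_value.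
- exact: (measurable_horizon_value N.+1).
Qed.

Lemma horizon_value_homo x :
  {homo (fun N => horizon_value N x) : m n / (m <= n)%N >-> m <= n}.
Proof.
by apply: homo_leq => [//|y u v|n]; [exact: le_trans|exact: horizon_value_le].
Qed.

Definition infinite_horizon_value (x : E) : \bar R :=
  limn (fun N => horizon_value N x).

Lemma horizon_value_cvg x :
  horizon_value N x @[N --> \oo] --> infinite_horizon_value x.
Proof. exact: (ereal_nondecreasing_is_cvgn (@horizon_value_homo x)). Qed.

Lemma horizon_value_le_lim N x : horizon_value N x <= infinite_horizon_value x.
Proof.
apply: lime_ge; first exact: (ereal_nondecreasing_is_cvgn (@horizon_value_homo x)).
near=> M; apply: horizon_value_homo; near: M; exact: nbhs_infty_ge.
Unshelve. all: by end_near. Qed.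

Lemma infinite_horizon_value_le x c :
  (forall N, horizon_value N x <= c) -> infinite_horizon_value x <= c.
Proof.
move=> h; apply: lime_le; first exact: (ereal_nondecreasing_is_cvgn (@horizon_value_homo x)).
exact: nearW.
Qed.

Lemma infinite_horizon_value_ge0 x : 0 <= infinite_horizon_value x.
Proof. by apply: le_trans (horizon_value_le_lim 0 x). Qed.

Lemma measurable_infinite_horizon_value :
  measurable_fun setT infinite_horizon_value.
Proof.
apply: (emeasurable_fun_cvg horizon_value); first exact: measurable_horizon_value.
by move=> x _; exact: horizon_value_cvg.
Qed.

(** Monotone convergence, in the form in which bounds on all finite horizons
    pass to the limit. *)
Lemma infinite_horizon_value_integral {d} {T : measurableType d}
    (m : {measure set T -> \bar R}) (A : set T) (c : R) (Y : T -> E) (b : \bar R) :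
  measurable A -> (0 <= c)%R -> measurable_fun setT Y ->
  (forall N, \int[m]_(w in A) (c%:E * horizon_value N (Y w)) <= b) ->
  \int[m]_(w in A) (c%:E * infinite_horizon_value (Y w)) <= b.
Proof.
move=> mA c0 mY hb.
have mcN N : measurable_fun A (fun w => c%:E * horizon_value N (Y w)).
  apply: measurable_funeM; apply: measurable_funTS.
  exact: (measurableT_comp (measurable_horizon_value N) mY).
have cN0 N w : 0 <= c%:E * horizon_value N (Y w).
  by rewrite mule_ge0 ?lee_fin// horizon_value_ge0.
have cNh w : {homo (fun N => c%:E * horizon_value N (Y w)) :
    M N / (M <= N)%N >-> M <= N}.
  by move=> M N MN; rewrite lee_wpmul2l ?lee_fin//; exact: horizon_value_homo.
have <- : \int[m]_(w in A) limn (fun N => c%:E * horizon_value N (Y w)) =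
    \int[m]_(w in A) (c%:E * infinite_horizon_value (Y w)).
  apply: eq_integral => w _; apply/cvg_lim => //.
  by apply: cvgeZl => //; exact: horizon_value_cvg.
rewrite monotone_convergence//.
apply: lime_le; last exact: nearW.
apply: ereal_nondecreasing_is_cvgn => M N MN; apply: ge0_le_integral => //.
by move=> w _; exact: cNh.
Qed.

Lemma bellman_equation x : infinite_horizon_value x =
  maxe (f x)%:E (alpha%:E * \int[Pi x]_y infinite_horizon_value y).
Proof.
apply/eqP; rewrite eq_le; apply/andP; split.
  apply: infinite_horizon_value_le => -[|N].
    rewrite /= le_max; apply/orP; right.
    apply: mule_ge0 => //; apply: integral_ge0 => y _.
    exact: infinite_horizon_value_ge0.
  rewrite /= ge_max !le_max lexx /=; apply/orP; right.
  apply: lee_wpmul2l => //; apply: ge0_le_integral => //.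
  - by move=> y _; exact: horizon_value_ge0.
  - exact: measurable_horizon_value.
  - exact: measurable_infinite_horizon_value.
  - by move=> y _; exact: horizon_value_le_lim.
rewrite ge_max; apply/andP; split.
  by apply: le_trans (horizon_value_le_lim 1 x); rewrite /= le_max lexx.
rewrite -ge0_integralZl//; last 2 first.
- exact: measurable_infinite_horizon_value.
- by move=> y _; exact: infinite_horizon_value_ge0.
apply: (infinite_horizon_value_integral (Y := id)) => //.
move=> N; apply: le_trans (horizon_value_le_lim N.+1 x).
rewrite ge0_integralZl//.
- by rewrite /= le_max lexx orbT.
- exact: measurable_horizon_value.
- by move=> y _; exact: horizon_value_ge0.
Qed.

End value_iteration.

Section value_of_process.
Context {R : realType} {dE : measure_display} {E : measurableType dE}
        {dO : measure_display} {Omega : measurableType dO}.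
Local Open Scope ereal_scope.
Variables (Pi : R.-pker E ~> E) (alpha : R) (f : E -> R).
Hypotheses (alpha0 : (0 < alpha)%R) (mf : measurable_fun setT f).
Variables (P : probability Omega R)
          (X : nat -> Omega -> E) (xa xb : nat -> Omega -> R) (x : E).
Hypothesis mkv : markov_process Pi P X x.
Hypothesis mxa : forall n, measurable_fun setT (xa n).
Hypothesis iidb : iid_uniform P xb.
Hypothesis indep : forall A1 A2 A3, sigma_of setT X A1 -> sigma_of setT xa A2 ->
  sigma_of setT xb A3 -> P (A1 `&` A2 `&` A3) = P A1 * P A2 * P A3.
Variable Z : nat -> Omega -> \bar R.
Hypothesis tZ : tail_envelope alpha P X f Z.

Let mX n : measurable_fun setT (X n). Proof. by case: mkv. Qed.
Let mxb n : measurable_fun setT (xb n). Proof. by case: iidb. Qed.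
Let a0 : 0 <= alpha%:E. Proof. by rewrite lee_fin ltW. Qed.
Let mZ n : measurable_fun setT (Z n). Proof. by case: tZ. Qed.
Let fZ n w : (alpha ^+ n * `|f (X n w)|)%:E <= Z n w. Proof. by case: tZ. Qed.
Let ZS n w : Z n.+1 w <= Z n w. Proof. by case: tZ. Qed.
Let Z0 n w : 0 <= Z n w.
Proof. by apply: le_trans (fZ n w); rewrite lee_fin mulr_ge0 ?exprn_ge0// ltW. Qed.

(** Induction on the horizon, for all [n] and [A] at once: where stopping is
    optimal the value is f(X_n), which Z_n dominates; on the rest of [A] the
    Markov property leads to X_{n+1} and a shorter horizon, and
    Z_{n+1} <= Z_n. *)
Lemma horizon_value_envelope N n A : <<s past X xa xb n setT >> A ->
  \int[P]_(w in A) ((alpha ^+ n)%:E * horizon_value Pi alpha f N (X n w)) <=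
  \int[P]_(w in A) Z n w.
Proof.
have an0 k : (0 <= alpha ^+ k)%R by rewrite exprn_ge0// ltW.
elim: N n A => [|N IH] n A pA.
  have mA : measurable A by move: pA; apply: gsigma_sub; exact: past_measurable.
  rewrite /= (eq_integral (cst 0)); last by move=> w _; rewrite mule0.
  by rewrite integral0 integral_ge0.
pose W := horizon_value Pi alpha f N.
pose c y := alpha%:E * \int[Pi y]_z W z.
have mW : measurable_fun setT W by exact: measurable_horizon_value.
have W0 y : 0 <= W y by exact: horizon_value_ge0.
have mc : measurable_fun setT c.
  by apply: measurable_funeM; exact: measurable_kernel_integral.
have c0 y : 0 <= c y.
  by apply: mule_ge0 => //; apply: integral_ge0.
(* Where stopping at once is optimal. *)
pose S := [set y | c y <= (f y)%:E].
have mS : measurable S.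
  rewrite -[S]setTI; apply: emeasurable_fun_le => //; exact/measurable_EFinP.
have pS : <<s past X xa xb n setT >> (X n @^-1` S).
  by have := @past_X _ _ _ _ _ X xa xb n setT n (leqnn n) measurableT _ mS; rewrite setTI.
pose TP : measurableType _ := g_sigma_algebraType (past X xa xb n setT).
have pA1 : <<s past X xa xb n setT >> (A `&` X n @^-1` S).
  exact: (@measurableI _ TP).
have pA2 : <<s past X xa xb n setT >> (A `\` X n @^-1` S).
  exact: (@measurableD _ TP).
have toM B : <<s past X xa xb n setT >> B -> measurable B.
  by apply: gsigma_sub; exact: past_measurable.
have [mA mA1 mA2] := And3 (toM _ pA) (toM _ pA1) (toM _ pA2).
have disj : [disjoint A `&` X n @^-1` S & A `\` X n @^-1` S].
  by apply/disj_setPS => w /= [[_ Sw] [_ /(_ Sw)]].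
have mV : measurable_fun setT (fun w => (alpha ^+ n)%:E * horizon_value Pi alpha f N.+1 (X n w)).
  apply: measurable_funeM; apply: (measurableT_comp _ (mX n)).
  exact: measurable_horizon_value.
have V0 w : 0 <= (alpha ^+ n)%:E * horizon_value Pi alpha f N.+1 (X n w).
  by rewrite mule_ge0// ?lee_fin//; exact: horizon_value_ge0.
rewrite -(setUIDK A (X n @^-1` S)).
rewrite !ge0_integral_setU//; first apply: leeD; try exact: measurable_funTS.
- apply: ge0_le_integral => //; try exact: measurable_funTS.
  move=> w [_ Sw]; apply: le_trans (fZ n w).
  rewrite /= (max_idPl Sw) -EFinM lee_fin ler_wpM2l//.
  exact: ler_norm.
- rewrite (eq_integral (fun w => \int[Pi (X n w)]_y ((alpha ^+ n.+1)%:E * W y))); last first.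
    move=> w; rewrite inE => -[_ /= nS].
    rewrite ge0_integralZl//; last by rewrite lee_fin.
    rewrite exprSr EFinM -muleA; congr (_ * _).
    apply/max_idPr; rewrite leNgt; apply/negP => /ltW; exact: nS.
  rewrite -(markov_past mkv mxa iidb indep pA2 (u := fun y => (alpha ^+ n.+1)%:E * W y))//.
  + apply: le_trans (IH n.+1 _ _) _.
      move: pA2; apply: sub_sigma_algebra2 => B [B1 [B2 [B3 [s1 s2 s3 ->]]]].
      exists B1, B2, B3; split=> //; move: s1; apply: sigma_of_subset => k /=.
      exact: ltnW.
    apply: ge0_le_integral => //; try exact: measurable_funTS.
  + exact: measurable_funeM.
  + by move=> y; rewrite mule_ge0// lee_fin.
Qed.

Lemma value_envelope n :
  \int[P]_w ((alpha ^+ n)%:E * infinite_horizon_value Pi alpha f (X n w)) <=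
  \int[P]_w Z n w.
Proof.
apply: infinite_horizon_value_integral => //; first by rewrite exprn_ge0// ltW.
move=> N; apply: horizon_value_envelope.
exact: (@measurableT _ (g_sigma_algebraType (past X xa xb n setT))).
Qed.

End value_of_process.

Lemma integral_initial {R : realType} {dE : measure_display}
    {E : measurableType dE} {dO : measure_display} {Omega : measurableType dO}
    (Pi : R.-pker E ~> E) (P : probability Omega R) (X : nat -> Omega -> E)
    (x : E) (u : E -> \bar R) :
  markov_process Pi P X x -> measurable_fun setT u -> (forall y, 0 <= u y)%E ->
  (\int[P]_w u (X 0%N w) = u x)%E.
Proof.
move=> [mX X0 _] mu u0.
rewrite -(ge0_integral_pushforward (mX 0%N) P measurableT mu)//.
rewrite (eq_measure_integral (\d_x : {measure set E -> \bar R}))//.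
  by rewrite integral_dirac// diracT mul1e.
by move=> A mA _; exact: X0.
Qed.

(** * Solutions of the optimal stopping equation *)

Section stopping_problem.
Context {R : realType} {dE : measure_display} {E : measurableType dE}
        {dO : measure_display} {Omega : measurableType dO}.
Variables (Pi : R.-pker E ~> E) (alpha : R).
Hypotheses (alpha0 : 0 < alpha) (alpha1 : alpha < 1).
Variables (P : E -> probability Omega R) (X : nat -> Omega -> E)
          (xi1 xi2 : nat -> Omega -> R) (T : Omega -> nat).
Hypothesis setting : game_setting Pi alpha P X xi1 xi2 T.

Lemma setting_indep x A1 A2 A3 : sigma_of setT X A1 -> sigma_of setT xi1 A2 ->
  sigma_of setT xi2 A3 ->
  (P x (A1 `&` A2 `&` A3) = P x A1 * P x A2 * P x A3)%E.
Proof.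
move=> s1 s2 s3; have [_ _ _ _ ind] := setting x.
have sT : sigma_rv T setT by exists setT; rewrite ?setTI ?preimage_setT.
by have := ind _ _ _ _ s1 s2 s3 sT; rewrite setIT probability_setT mule1.
Qed.

Lemma setting_indep_time x k A : sigma_of setT X A ->
  (P x (A `&` T @^-1` [set k]) = P x A * P x (T @^-1` [set k]))%E.
Proof.
move=> sA; have [_ _ _ _ ind] := setting x.
have sT : sigma_rv T (T @^-1` [set k]) by exists [set k]; rewrite ?setTI.
have := ind _ _ _ _ sA (@sigma_ofT _ _ _ _ xi1 setT) (@sigma_ofT _ _ _ _ xi2 setT) sT.
by rewrite !setIT probability_setT !mule1.
Qed.

Lemma tail_envelope_exists (f : E -> R) x : measurable_fun setT f ->
  sup_killed_integrable P X T f -> exists Z, tail_envelope alpha (P x) X f Z.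
Proof.
move=> mf intf; have [[mX _ _] _ _ gT _] := setting x.
apply: (discounted_envelope alpha0 alpha1 mf mX gT) (intf x) => k A.
exact: setting_indep_time.
Qed.

(** The last clause is transversality.  It excludes spurious solutions of the
    fixed point equation, such as those growing like alpha^-n along X. *)
Definition bellman_solution (f U : E -> R) :=
  [/\ measurable_fun setT U, forall x, 0 <= U x,
      forall x, U x = Num.max (f x) (alpha * kernel_op Pi U x),
      forall x, (\int[Pi x]_y (U y)%:E < +oo)%E
    & forall x, (forall n, (\int[P x]_w (alpha ^+ n * U (X n w))%:E < +oo)%E) /\
        (\int[P x]_w (alpha ^+ n * U (X n w))%:E)%E @[n --> \oo] --> 0%E].

(** The limit of value iteration is finite at x because the envelope under
    [P x] bounds it at time 0. *)
Lemma bellman_solution_exists (f : E -> R) : measurable_fun setT f ->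
  sup_killed_integrable P X T f -> exists U, bellman_solution f U.
Proof.
move=> mf intf; pose V := infinite_horizon_value Pi alpha f.
have V0 x : (0 <= V x)%E by exact: infinite_horizon_value_ge0.
have mV : measurable_fun setT V by exact: measurable_infinite_horizon_value.
have env x Z : tail_envelope alpha (P x) X f Z -> forall n,
    (\int[P x]_w ((alpha ^+ n)%:E * V (X n w)) <= \int[P x]_w Z n w)%E.
  move=> tZ n; have [mk [m1 _ _] u2 _ _] := setting x.
  exact: (value_envelope alpha0 mf mk m1 u2 (@setting_indep x) tZ).
have Voo x : (V x < +oo)%E.
  have [Z tZ] := tail_envelope_exists x mf intf.
  have [_ _ _ Z0oo _] := tZ; apply: le_lt_trans Z0oo.
  apply: le_trans (env x Z tZ 0%N); rewrite expr0.
  under eq_integral do rewrite mul1e.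
  by have [mk _ _ _ _] := setting x; rewrite (integral_initial mk).
pose U x := fine (V x).
have UE x : (U x)%:E = V x by rewrite fineK// ge0_fin_numE.
have bell x := bellman_equation Pi alpha0 mf x.
(* If the integral were infinite, the optimality equation would make V
   infinite. *)
have PiVoo x : (\int[Pi x]_y V y < +oo)%E.
  rewrite ltey; apply/negP => /eqP e.
  have := Voo x; rewrite /V bell -/V e gt0_muley ?lte_fin//.
  by rewrite gt_max ltxx andbF.
have kU x : (kernel_op Pi U x)%:E = (\int[Pi x]_y V y)%E.
  rewrite /kernel_op /Rintegral; under eq_integral do rewrite UE.
  by rewrite fineK// ge0_fin_numE// integral_ge0.
exists U; split.
- exact: measurableT_comp.
- by move=> x; rewrite fine_ge0.
- move=> x; apply: EFin_inj; rewrite UE /V bell -/V EFin_max EFinM kU.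
  by [].
- by move=> x; under eq_integral do rewrite UE.
- move=> x; have [Z tZ] := tail_envelope_exists x mf intf.
  have e n : (\int[P x]_w (alpha ^+ n * U (X n w))%:E =
      \int[P x]_w ((alpha ^+ n)%:E * V (X n w)))%E.
    by under eq_integral do rewrite EFinM UE.
  have := env x Z tZ; case: tZ => [mZ fZ ZS Z0oo Zlim] envx.
  have Zpos n w : (0 <= Z n w)%E.
    by apply: le_trans (fZ n w); rewrite lee_fin mulr_ge0// exprn_ge0// ltW.
  split=> [n|].
    rewrite e (le_lt_trans (envx n))// (le_lt_trans _ Z0oo)//.
    elim: n => [//|n IH]; apply: le_trans IH.
    by apply: ge0_le_integral => // w _; exact: ZS.
  under eq_fun do rewrite e.
  apply: (squeeze_cvge _ (cvg_cst 0%E) Zlim); apply: nearW => n.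
  rewrite envx andbT; apply: integral_ge0 => w _.
  by rewrite mule_ge0// lee_fin exprn_ge0// ltW.
Qed.

End stopping_problem.
(** * The payoff as a sum over stages *)

Section stages.
Context {R : realType} {dE : measure_display} {E : measurableType dE}
        {dO : measure_display} {Omega : measurableType dO}.

Definition not_before (s : option nat) (n : nat) : bool :=
  if s is Some m then (n <= m)%N else true.

Lemma not_beforeS s n : not_before s n.+1 = ~~ time_le s n.
Proof. by case: s => //= m; rewrite -ltnNge. Qed.

Lemma not_before_split s n :
  not_before s n = (s == Some n) || not_before s n.+1.
Proof.
by case: s => //= m; rewrite leq_eqVlt eq_sym.
Qed.

Lemma not_before_Some n : not_before (Some n) n.+1 = false.
Proof. by rewrite /= ltnn. Qed.

Variables (alpha : R) (X : nat -> Omega -> E).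

Section markov_time_facts.
Variables (xi : nat -> Omega -> R) (p : E -> R).
Local Notation tau := (markov_time X xi p).

(** Only the draws with index below [n] matter: this is why surviving until
    [n] belongs to a past that does not contain the draw of time [n]. *)
Lemma not_before_markov_time w n :
  not_before (tau w) n <-> forall k, (k < n)%N -> p (X k w) < xi k w.
Proof.
rewrite /markov_time; case: pselect => [ex|nex] /=; last first.
  by split=> // _ k _; rewrite ltNge; apply/negP => h; apply: nex; exists k.
case: ex_minnP => m xm mmin; split=> [nm k kn|h].
  rewrite ltNge; apply/negP => /mmin mk.
  by have := leq_trans nm mk; rewrite leqNgt kn.
by rewrite leqNgt; apply/negP => /h; rewrite ltNge xm.
Qed.

Lemma markov_time_now w n :
  not_before (tau w) n -> (tau w == Some n) = (xi n w <= p (X n w)).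
Proof.
move=> nb; apply/idP/idP.
  rewrite /markov_time; case: pselect => [ex|//].
  by case: ex_minnP => m xm _ /eqP[<-].
move=> xn; move: nb; rewrite not_before_split => /orP[//|].
by move=> /not_before_markov_time /(_ n (ltnSn n)); rewrite ltNge xn.
Qed.

Lemma not_before_markov_time_measurable (G : set (set Omega)) n :
  measurable_fun setT p ->
  (forall k, (k < n)%N -> measurable_wrt G (X k)) ->
  (forall k, (k < n)%N -> measurable_wrt G (xi k)) ->
  <<s G >> [set w | not_before (tau w) n].
Proof.
move=> mp mX mxi; pose TG : measurableType _ := g_sigma_algebraType G.
have -> : [set w | not_before (tau w) n] =
    \bigcap_(k in `I_n) [set w | p (X k w) < xi k w].
  apply/seteqP; split=> w /=.
    by move=> /not_before_markov_time h k; exact: h.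
  by move=> h; apply/not_before_markov_time => k; exact: h.
apply: (@bigcap_measurableType _ TG) => k /= kn.
rewrite -[X in measurable X]setTI.
apply: (@measurable_fun_ltr _ TG) => //; last exact: mxi.
exact: (measurable_wrt_comp mp (mX k kn)).
Qed.

End markov_time_facts.

Variables (f g : E -> R) (tau sigma : Omega -> option nat).

(** As long as both players are alive at time [n], the first player may stop
    ([stops_first], earning f even if the opponent stops simultaneously) or not
    ([neither_before]); in the second case the opponent may still stop at [n]
    ([opponent_stops]). *)
Definition stops_first n : set Omega :=
  [set w | (tau w == Some n) && not_before (sigma w) n].
Definition neither_before n : set Omega :=
  [set w | not_before (tau w) n.+1 && not_before (sigma w) n].
Definition opponent_stops n : set Omega :=
  [set w | not_before (tau w) n.+1 && (sigma w == Some n)].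
Definition both_alive n : set Omega :=
  [set w | not_before (tau w) n && not_before (sigma w) n].

(** What the first player collects at time [n]; simultaneous stopping pays
    [f]. *)
Definition stage n (w : Omega) : R :=
  (if (tau w == Some n) && not_before (sigma w) n
   then alpha ^+ n * f (X n w) else 0) +
  (if not_before (tau w) n.+1 && (sigma w == Some n)
   then alpha ^+ n * g (X n w) else 0).

Lemma stage_payoff n w : not_before (tau w) n -> not_before (sigma w) n ->
  stage n w = if not_before (tau w) n.+1 && not_before (sigma w) n.+1 then 0
              else payoff alpha X f g f tau sigma w.
Proof.
rewrite /stage /payoff /discounted.
case: (tau w) (sigma w) => [m|] [k|] /=; rewrite ?(inj_eq Some_inj).
- rewrite [(n <= m)%N]leq_eqVlt => /predU1P[<-|nm].
    rewrite eqxx ltnn /= leq_eqVlt => /predU1P[<-|nk].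
      by rewrite eqxx ltnn /= !(mulr0, mulr1, addr0, add0r).
    by rewrite nk (ltn_eqF nk) ltnNge (ltnW nk) orbT /= !(mulr0, mulr1, addr0, add0r).
  rewrite nm (gtn_eqF nm) /= leq_eqVlt => /predU1P[<-|nk].
    rewrite nm eqxx ltnn (gtn_eqF nm) ltnNge (ltnW nm) /=.
    by rewrite !(mulr0, mulr1, addr0, add0r).
  by rewrite nk (gtn_eqF nk) addr0.
- rewrite leq_eqVlt => /predU1P[<-|nm] _.
    by rewrite eqxx ltnn /= !(mulr0, mulr1, addr0, add0r).
  by rewrite nm (gtn_eqF nm) /= addr0.
- move=> _; rewrite leq_eqVlt => /predU1P[<-|nk].
    by rewrite eqxx ltnn !(mulr0, mulr1, addr0, add0r).
  by rewrite nk (gtn_eqF nk) addr0.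
- by rewrite addr0.
Qed.

(** Only the stage at which somebody stops first can be nonzero, and it carries
    the whole payoff. *)
Lemma payoff_partial_sum N w : \sum_(n < N) stage n w =
  if not_before (tau w) N && not_before (sigma w) N then 0
  else payoff alpha X f g f tau sigma w.
Proof.
elim: N => [|N IH].
  by rewrite big_ord0; case: (tau w) (sigma w) => [?|] [?|].
rewrite big_ord_recr /= IH; case: ifPn => [/andP[ta sa]|dead].
  by rewrite add0r stage_payoff.
rewrite /stage !(not_before_split _ N) in dead *.
move: dead; case: (tau w == Some N); case: (sigma w == Some N);
  by case: (not_before (tau w) N.+1); case: (not_before (sigma w) N.+1);
  rewrite //= ?addr0.
Qed.

End stages.
(** * Verification against a Markovian opponent *)

Section verification.
Context {R : realType} {dE : measure_display} {E : measurableType dE}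
        {dO : measure_display} {Omega : measurableType dO}.
Variables (Pi : R.-pker E ~> E) (alpha : R).
Hypothesis alpha0 : 0 < alpha.
Variables (P : probability Omega R) (X : nat -> Omega -> E)
          (xa xb : nat -> Omega -> R) (x : E).
Hypothesis mkv : markov_process Pi P X x.
Hypothesis mxa : forall n, measurable_fun setT (xa n).
Hypothesis iidb : iid_uniform P xb.
Hypothesis indep : forall A1 A2 A3, sigma_of setT X A1 -> sigma_of setT xa A2 ->
  sigma_of setT xb A3 -> (P (A1 `&` A2 `&` A3) = P A1 * P A2 * P A3)%E.

Let mX n : measurable_fun setT (X n). Proof. by case: mkv. Qed.
Let mxb n : measurable_fun setT (xb n). Proof. by case: iidb. Qed.

Let past_m n J A : <<s past X xa xb n J >> A -> measurable A.
Proof. by apply: gsigma_sub; exact: past_measurable. Qed.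

Lemma past_subset m n I J : (m <= n)%N -> I `<=` J ->
  <<s past X xa xb m I >> `<=` <<s past X xa xb n J >>.
Proof.
move=> mn IJ; apply: sub_sigma_algebra2 => B [B1 [B2 [B3 [s1 s2 s3 ->]]]].
exists B1, B2, B3; split=> //; last exact: sigma_of_subset s3.
by move: s1; apply: sigma_of_subset => k /= km; exact: leq_trans km _.
Qed.

Lemma player_filtration_past n : player_filtration X xa n `<=`
  <<s past X xa xb n `I_n >>.
Proof.
apply: smallest_sub; first exact: smallest_sigma_algebra.
move=> A [k /= kn [|]] [B mB <-]; rewrite setTI.
  by have := @past_X _ _ _ _ _ X xa xb n `I_n k kn measurableT B mB; rewrite setTI.
exact: past_xa.
Qed.

Lemma envelope_integrable v Z n : measurable_fun setT v ->
  tail_envelope alpha P X v Z ->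
  P.-integrable setT (fun w => (alpha ^+ n * v (X n w))%:E).
Proof.
move=> mv [mZ vZ ZS Z0oo _].
have Z0 m w : (0 <= Z m w)%E.
  by apply: le_trans (vZ m w); rewrite lee_fin mulr_ge0 ?exprn_ge0// ltW.
have iZ : P.-integrable setT (Z 0%N).
  apply/integrableP; split=> //.
  by under eq_integral do rewrite gee0_abs//.
apply: (le_integrable _ _ _ iZ) => //.
  apply/measurable_EFinP; apply: measurable_funM => //.
  exact: (measurableT_comp mv (mX n)).
move=> w _; rewrite [leRHS]gee0_abs//= normrM (ger0_norm (exprn_ge0 n (ltW alpha0))).
apply: le_trans (vZ n w) _; elim: n => [//|n IH].
exact: le_trans (ZS n w) IH.
Qed.

Variable p : E -> R.
Hypotheses (mp : measurable_fun setT p) (p01 : forall y, 0 <= p y <= 1).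

(* The opponent, if still alive, stops at time n. *)
Let C n : set Omega := [set w | xb n w <= p (X n w)].

Let past_C n : <<s past X xa xb n setT >> (C n).
Proof.
pose TP : measurableType _ := g_sigma_algebraType (past X xa xb n setT).
rewrite -[C n]setTI; apply: (@measurable_fun_ler _ TP) => //.
  exact: past_xb.
have mpX : measurable_wrt (past X xa xb n setT) (p \o X n).
  by apply: measurable_wrt_comp => //; exact: past_X.
exact: mpX.
Qed.

Let mC n : measurable (C n). Proof. exact: (@past_m n setT _ (@past_C n)). Qed.

Lemma randomized_stop_ge0 n D (u : E -> \bar R) : <<s past X xa xb n `I_n >> D ->
  measurable_fun setT u -> (forall y, 0 <= u y)%E ->
  (\int[P]_(w in D `&` C n) u (X n w) =
   \int[P]_(w in D) ((p (X n w))%:E * u (X n w)))%E.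
Proof.
move=> pD mu u0.
have mXn := @past_X _ _ _ _ _ X xa xb n `I_n n (leqnn n).
rewrite setIC integral_mkcondr (@integral_indep_uniform _ _ _ (past X xa xb n `I_n)
  P (xb n) (p \o X n))//.
- rewrite [RHS]integral_mkcond; apply: eq_integral => w _ /=.
  by rewrite !patchE; case: ifP => // _; rewrite mule0.
- by apply: gsigma_sub; exact: past_measurable.
- by move=> A B pA mB; exact: (past_indep mkv mxa iidb indep pA mB).
- exact: measurable_wrt_comp.
- by move=> w; exact: p01.
- apply/(@measurable_restrict _ _ (g_sigma_algebraType (past X xa xb n `I_n))) => //.
  by apply: measurable_funTS; exact: (measurable_wrt_comp mu mXn).
- by move=> w; rewrite patchE; case: ifP.
Qed.

(** The positive and negative parts of both sides have equal integrals, so the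
    real-valued integrals agree even when they are junk values. *)
Lemma randomized_stop n D (v : E -> R) : <<s past X xa xb n `I_n >> D ->
  measurable_fun setT v ->
  \int[P]_(w in D `&` C n) v (X n w) = \int[P]_(w in D) (p (X n w) * v (X n w)).
Proof.
move=> pD mv; congr fine.
have posE (y : E) : (maxe (p y * v y)%:E 0 = (p y)%:E * maxe (v y)%:E 0)%E.
  by case/andP: (p01 y) => p0 _; rewrite -!EFin_max -EFinM maxr_pMr// mulr0.
have negE (y : E) :
    (maxe (- (p y * v y)%:E) 0 = (p y)%:E * maxe (- (v y)%:E) 0)%E.
  case/andP: (p01 y) => p0 _.
  by rewrite -!EFinN -!EFin_max -EFinM maxr_pMr// mulr0 mulrN.
have mv' : measurable_fun setT (EFin \o v) by exact/measurable_EFinP.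
rewrite integralE [RHS]integralE; congr (_ - _)%E.
- transitivity (\int[P]_(w in D `&` C n) (EFin \o v)^\+ (X n w))%E.
    by apply: eq_integral => w _; rewrite !funeposE.
  rewrite randomized_stop_ge0//; last exact: measurable_funepos.
  by apply: eq_integral => w _; rewrite !funeposE posE.
- transitivity (\int[P]_(w in D `&` C n) (EFin \o v)^\- (X n w))%E.
    by apply: eq_integral => w _; rewrite !funenegE.
  rewrite randomized_stop_ge0//; last exact: measurable_funeneg.
  by apply: eq_integral => w _; rewrite !funenegE negE.
Qed.

Variable U : E -> R.
Hypotheses (mU : measurable_fun setT U) (U0 : forall y, 0 <= U y)
  (PiU : forall y, (\int[Pi y]_z (U z)%:E < +oo)%E)
  (Ufin : forall n, (\int[P]_w (alpha ^+ n * U (X n w))%:E < +oo)%E).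

Local Notation kU := (kernel_op Pi U).

Lemma kernel_opE y : (kU y)%:E = (\int[Pi y]_z (U z)%:E)%E.
Proof.
rewrite /kernel_op /Rintegral fineK// ge0_fin_numE// integral_ge0// => z _.
by rewrite lee_fin.
Qed.

Lemma kernel_op_ge0 y : 0 <= kU y.
Proof. by rewrite -lee_fin kernel_opE integral_ge0// => z _; rewrite lee_fin. Qed.

Lemma measurable_kernel_op : measurable_fun setT kU.
Proof.
apply/measurable_EFinP.
rewrite (_ : EFin \o kU = fun y => \int[Pi y]_z (U z)%:E)%E; last first.
  by apply/funext => y /=; exact: kernel_opE.
apply: measurable_kernel_integral => [|y]; last by rewrite lee_fin.
exact/measurable_EFinP.
Qed.

Lemma markov_step n D : <<s past X xa xb n setT >> D ->
  (\int[P]_(w in D) (alpha ^+ n.+1 * U (X n.+1 w))%:E =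
   \int[P]_(w in D) (alpha ^+ n.+1 * kU (X n w))%:E)%E.
Proof.
move=> pD; have an0 : 0 <= alpha ^+ n.+1 by rewrite exprn_ge0// ltW.
have h := markov_past mkv mxa iidb indep pD (u := fun y => (alpha ^+ n.+1 * U y)%:E).
rewrite h.
- apply: eq_integral => w _; rewrite EFinM kernel_opE.
  under eq_integral do rewrite EFinM.
  rewrite ge0_integralZl//; first exact/measurable_EFinP.
  by move=> z _; rewrite lee_fin.
- by apply/measurable_EFinP; exact: measurable_funM.
- by move=> y; rewrite lee_fin mulr_ge0.
Qed.

Lemma discounted_U_integrable n :
  P.-integrable setT (fun w => (alpha ^+ n * U (X n w))%:E).
Proof.
apply/integrableP; split.
  by apply/measurable_EFinP; apply: measurable_funM => //; exact: measurableT_comp.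
under eq_integral do rewrite gee0_abs ?lee_fin ?mulr_ge0 ?exprn_ge0 ?(ltW alpha0)//.
exact: Ufin.
Qed.

Lemma discounted_kU_integrable n :
  P.-integrable setT (fun w => (alpha ^+ n.+1 * kU (X n w))%:E).
Proof.
apply/integrableP; split.
  apply/measurable_EFinP; apply: measurable_funM => //.
  by apply: measurableT_comp => //; exact: measurable_kernel_op.
under eq_integral do
  rewrite gee0_abs ?lee_fin ?mulr_ge0 ?kernel_op_ge0 ?exprn_ge0 ?(ltW alpha0)//.
rewrite -markov_step//.
exact: (@measurableT _ (g_sigma_algebraType (past X xa xb n setT))).
Qed.

(** Given that the opponent goes on, which has weight 1 - p(X_n), the next state
    is distributed according to the kernel.  The Markov property is applied
    first, with the draw of time [n] in the past, and the draw is then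
    integrated out. *)
Lemma randomized_continue n D : <<s past X xa xb n `I_n >> D ->
  \int[P]_(w in D `\` C n) (alpha ^+ n.+1 * U (X n.+1 w)) =
  \int[P]_(w in D) ((1 - p (X n w)) * (alpha ^+ n.+1 * kU (X n w))).
Proof.
move=> pD; pose Y w := alpha ^+ n.+1 * kU (X n w).
have mD := @past_m n _ _ pD.
have pDT : <<s past X xa xb n setT >> D by exact: past_subset pD.
have intY B : measurable B -> P.-integrable B (EFin \o Y).
  by move=> mB; apply: integrableS (discounted_kU_integrable n).
have intpY : P.-integrable D (EFin \o (fun w => p (X n w) * Y w)).
  apply: (le_integrable _ _ _ (intY D mD)) => //.
    apply: measurable_funTS; apply/measurable_EFinP; apply: measurable_funM.
      exact: measurableT_comp.
    by apply: measurable_funM => //; apply: measurableT_comp => //; exact: measurable_kernel_op.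
  move=> w _; rewrite /= lee_fin normrM ler_piMl// ger0_norm;
    by case/andP: (p01 (X n w)).
transitivity (\int[P]_(w in D `\` C n) Y w).
  congr fine; apply: markov_step.
  exact: (@measurableD _ (g_sigma_algebraType (past X xa xb n setT))
    _ _ pDT (@past_C n)).
have split_D : \int[P]_(w in D) Y w =
    \int[P]_(w in D `&` C n) Y w + \int[P]_(w in D `\` C n) Y w.
  rewrite -{1}(setUIDK D (C n)) Rintegral_setU//.
  - exact: measurableI.
  - exact: measurableD.
  - by rewrite setUIDK; exact: intY.
  - by apply/disj_setPS => w /= [[_ Cw] [_ /(_ Cw)]].
have stop_D : \int[P]_(w in D `&` C n) Y w = \int[P]_(w in D) (p (X n w) * Y w).
  apply: (@randomized_stop n D (fun y => alpha ^+ n.+1 * kU y)) => //.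
  by apply: measurable_funM => //; exact: measurable_kernel_op.
have -> : \int[P]_(w in D `\` C n) Y w =
    \int[P]_(w in D) Y w - \int[P]_(w in D) (p (X n w) * Y w).
  by rewrite split_D stop_D [X in _ = X - _]addrC addrK.
rewrite -RintegralB//; last exact: intY.
by apply: eq_Rintegral => w _; rewrite mulrBl mul1r.
Qed.

Variables (f g : E -> R) (Zf Zg : nat -> Omega -> \bar R).
Hypotheses (mf : measurable_fun setT f) (mg : measurable_fun setT g)
  (envf : tail_envelope alpha P X f Zf) (envg : tail_envelope alpha P X g Zg).
Variable tau : Omega -> option nat.
Hypothesis stau : stopping_time (player_filtration X xa) tau.
Local Notation sigma := (markov_time X xb p).
Local Notation A := (stops_first tau sigma).
Local Notation B := (neither_before tau sigma).
Local Notation W y := (p y * g y + (1 - p y) * (alpha * kU y)).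

Lemma past_tau n : <<s past X xa xb n `I_n >> [set w | not_before (tau w) n.+1].
Proof.
have -> : [set w | not_before (tau w) n.+1] = ~` [set w | time_le (tau w) n].
  by apply/seteqP; split=> w /=; rewrite not_beforeS => /negP.
apply: (@measurableC _ (g_sigma_algebraType (past X xa xb n `I_n))).
by apply: player_filtration_past; exact: stau.
Qed.

Lemma past_tau_before n : <<s past X xa xb n `I_n >> [set w | not_before (tau w) n].
Proof.
case: n => [|n].
  have -> : [set w | not_before (tau w) 0] = setT.
    by apply/seteqP; split=> // w _ /=; case: (tau w).
  exact: (@measurableT _ (g_sigma_algebraType (past X xa xb 0 `I_0))).
move: (@past_tau n); apply: past_subset => //.
by move=> k /= /ltnW.
Qed.

Lemma past_sigma n : <<s past X xa xb n `I_n >> [set w | not_before (sigma w) n].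
Proof.
apply: not_before_markov_time_measurable => // k kn.
  by apply: past_X; exact: ltnW.
exact: past_xb.
Qed.

Lemma past_neither_before n : <<s past X xa xb n `I_n >> (B n).
Proof.
have -> : B n = [set w | not_before (tau w) n.+1] `&` [set w | not_before (sigma w) n].
  by rewrite /neither_before; apply/seteqP; split=> w /= => [/andP[]|[-> ->]].
apply: (@measurableI _ (g_sigma_algebraType (past X xa xb n `I_n))).
  exact: past_tau.
exact: past_sigma.
Qed.

Lemma past_stops_first n : <<s past X xa xb n `I_n >> (A n).
Proof.
have -> : A n = ([set w | not_before (tau w) n] `\` [set w | not_before (tau w) n.+1])
    `&` [set w | not_before (sigma w) n].
  rewrite /stops_first; apply/seteqP; split=> w /=; rewrite (not_before_split (tau w) n).
    move=> /andP[/eqP tn ->]; rewrite tn eqxx not_before_Some.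
    by split=> //; split.
  by move=> [[/orP[-> //|h] /(_ h)]].
apply: (@measurableI _ (g_sigma_algebraType (past X xa xb n `I_n))).
  apply: (@measurableD _ (g_sigma_algebraType (past X xa xb n `I_n))).
    exact: past_tau_before.
  exact: past_tau.
exact: past_sigma.
Qed.

Lemma opponent_stopsE n : opponent_stops tau sigma n = B n `&` C n.
Proof.
rewrite /opponent_stops /both_alive /neither_before; apply/seteqP; split=> w /=.
  move=> /andP[tn sn]; have nb : not_before (sigma w) n.
    by rewrite not_before_split sn.
  have Cw : xb n w <= p (X n w) by rewrite -(markov_time_now nb).
  by rewrite tn nb.
by move=> [/andP[-> nb] Cw] /=; rewrite markov_time_now.
Qed.

Lemma both_aliveSE n : both_alive tau sigma n.+1 = B n `\` C n.
Proof.
rewrite /opponent_stops /both_alive /neither_before; apply/seteqP; split=> w /=.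
  move=> /andP[tn sn]; have nb : not_before (sigma w) n.
    by rewrite not_before_split sn orbT.
  rewrite tn nb; split=> //.
  move=> Cw; have /eqP e : sigma w == Some n by rewrite markov_time_now.
  by move: sn; rewrite e not_before_Some.
move=> [/andP[-> nb] nC]; move: (nb); rewrite not_before_split => /orP[|-> //].
by rewrite markov_time_now// => /nC.
Qed.

Lemma both_aliveE n : both_alive tau sigma n = A n `|` B n.
Proof.
apply/seteqP; split=> w; rewrite /both_alive /stops_first /neither_before /=;
  rewrite (not_before_split (tau w) n).
  by move=> /andP[/orP[->|->] ->]; [left|right].
by move=> [/andP[-> ->]|/andP[-> ->]]; rewrite ?orbT.
Qed.

Lemma stops_first_disjoint n : [disjoint A n & B n].
Proof.
apply/disj_setPS => w /= [/andP[/eqP e _] /andP[h _]].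
by move: h; rewrite e not_before_Some.
Qed.

Let mA n : measurable (A n). Proof. exact: (@past_m n _ _ (@past_stops_first n)). Qed.
Let mB n : measurable (B n).
Proof. exact: (@past_m n _ _ (@past_neither_before n)). Qed.
Let mO n : measurable (opponent_stops tau sigma n).
Proof. by rewrite opponent_stopsE; exact: measurableI. Qed.

Let intf n D : measurable D ->
  P.-integrable D (fun w => (alpha ^+ n * f (X n w))%:E).
Proof. by move=> mD; apply: integrableS (envelope_integrable n mf envf). Qed.
Let intg n D : measurable D ->
  P.-integrable D (fun w => (alpha ^+ n * g (X n w))%:E).
Proof. by move=> mD; apply: integrableS (envelope_integrable n mg envg). Qed.
Let intU n D : measurable D ->
  P.-integrable D (fun w => (alpha ^+ n * U (X n w))%:E).
Proof. by move=> mD; apply: integrableS (discounted_U_integrable n). Qed.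

(** The expected payoff collected at time [n]. *)
Definition stage_value n : R :=
  \int[P]_(w in A n) (alpha ^+ n * f (X n w)) +
  \int[P]_(w in opponent_stops tau sigma n) (alpha ^+ n * g (X n w)).

(** The expected discounted value still to be played for at time [n]. *)
Definition alive_value n : R :=
  \int[P]_(w in both_alive tau sigma n) (alpha ^+ n * U (X n w)).

Let mpX n : measurable_fun setT (fun w => p (X n w)).
Proof. exact: measurableT_comp. Qed.

Let intgB n :
  P.-integrable (B n) (fun w => (p (X n w) * (alpha ^+ n * g (X n w)))%:E).
Proof.
apply: (le_integrable _ _ _ (intg n (mB n))) => //.
  apply: measurable_funTS; apply/measurable_EFinP; apply: measurable_funM => //.
  by apply: measurable_funM => //; exact: measurableT_comp.
move=> w _; rewrite /= lee_fin normrM ler_piMl// ger0_norm;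
  by case/andP: (p01 (X n w)).
Qed.

Let intuB n : P.-integrable (B n)
  (fun w => ((1 - p (X n w)) * (alpha ^+ n.+1 * kU (X n w)))%:E).
Proof.
apply: (le_integrable _ _ _ (integrableS _ _ _ (discounted_kU_integrable n))) => //.
  apply: measurable_funTS; apply/measurable_EFinP; apply: measurable_funM => //.
    exact: measurable_funB.
  by apply: measurable_funM => //; apply: measurableT_comp => //; exact: measurable_kernel_op.
move=> w _; rewrite /= lee_fin normrM ler_piMl// ger0_norm;
  by case/andP: (p01 (X n w)) => ? ?; lra.
Qed.

Let intW n : P.-integrable (B n) (fun w => (alpha ^+ n * W (X n w))%:E).
Proof.
apply: eq_integrable (integrableD _ (intgB n) (intuB n)) => // w _ /=.
by rewrite -EFinD exprS; congr EFin; ring.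
Qed.

(** One step of the game: a player who does not stop faces the lottery [W] over
    the opponent's payoff and the continuation value. *)
Lemma stage_valueE (n : nat) : stage_value n + alive_value n.+1 =
  \int[P]_(w in A n) (alpha ^+ n * f (X n w)) +
  \int[P]_(w in B n) (alpha ^+ n * W (X n w)).
Proof.
rewrite /stage_value /alive_value both_aliveSE opponent_stopsE -addrA.
congr (_ + _).
rewrite (randomized_stop (@past_neither_before n) (v := fun y => alpha ^+ n * g y)); last first.
  exact: measurable_funM.
rewrite randomized_continue; last exact: past_neither_before.
rewrite -RintegralD//.
by apply: eq_Rintegral => w _; rewrite exprS; ring.
Qed.

Lemma alive_value_split n : alive_value n =
  \int[P]_(w in A n) (alpha ^+ n * U (X n w)) +
  \int[P]_(w in B n) (alpha ^+ n * U (X n w)).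
Proof.
rewrite /alive_value both_aliveE Rintegral_setU//; last exact: stops_first_disjoint.
by apply: intU; exact: measurableU.
Qed.

Lemma alive_value_ge0 n : 0 <= alive_value n.
Proof.
apply: Rintegral_ge0 => w _; apply: mulr_ge0 => //.
by rewrite exprn_ge0// ltW.
Qed.

Lemma alive_value0 : alive_value 0 = U x.
Proof.
rewrite /alive_value (_ : both_alive _ _ 0 = setT); last first.
  by apply/seteqP; split=> // w _; rewrite /both_alive /=; case: (tau w) (sigma w) => [?|] [?|].
rewrite /Rintegral; under eq_integral do rewrite expr0 mul1r.
rewrite (integral_initial (u := EFin \o U) mkv)//; exact/measurable_EFinP.
Qed.

Lemma alive_value_cvg :
  (\int[P]_w (alpha ^+ n * U (X n w))%:E)%E @[n --> \oo] --> 0%E ->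
  (alive_value n)%:E @[n --> \oo] --> 0%E.
Proof.
move=> Ulim; apply: (squeeze_cvge _ (cvg_cst 0%E) Ulim); apply: nearW => n.
have mU' : measurable (both_alive tau sigma n) by rewrite both_aliveE; exact: measurableU.
rewrite lee_fin alive_value_ge0 /= /alive_value /Rintegral fineK; last first.
  by apply: integrable_fin_num => //; exact: intU.
apply: ge0_subset_integral => //.
  by have /integrableP[] := intU n measurableT.
by move=> w _; rewrite lee_fin mulr_ge0// exprn_ge0// ltW.
Qed.

Let stageE n w : stage alpha X f g tau sigma n w =
  ((fun w => alpha ^+ n * f (X n w)) \_ (A n)) w +
  ((fun w => alpha ^+ n * g (X n w)) \_ (opponent_stops tau sigma n)) w.
Proof.
rewrite /stage !patchE.
have inA : (w \in A n) = (tau w == Some n) && not_before (sigma w) n.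
  by apply/idP/idP; rewrite inE.
have inO : (w \in opponent_stops tau sigma n) =
    not_before (tau w) n.+1 && (sigma w == Some n).
  by apply/idP/idP; rewrite inE.
by rewrite inA inO.
Qed.

Lemma stage_integrable n :
  P.-integrable setT (fun w => (stage alpha X f g tau sigma n w)%:E).
Proof.
have i1 : P.-integrable setT (fun w =>
    (((fun w => alpha ^+ n * f (X n w)) \_ (A n)) w)%:E).
  rewrite -[X in _.-integrable _ X]/(EFin \o _) -restrict_EFin.
  by apply/integrable_restrict => //; rewrite setTI; exact: intf.
have i2 : P.-integrable setT (fun w =>
    (((fun w => alpha ^+ n * g (X n w)) \_ (opponent_stops tau sigma n)) w)%:E).
  rewrite -[X in _.-integrable _ X]/(EFin \o _) -restrict_EFin.
  by apply/integrable_restrict => //; rewrite setTI; exact: intg.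
by apply: eq_integrable (integrableD _ i1 i2) => // w _ /=; rewrite stageE.
Qed.

Lemma stage_integral n :
  \int[P]_w stage alpha X f g tau sigma n w = stage_value n.
Proof.
rewrite /stage_value [X in _ = X + _]Rintegral_mkcond [X in _ = _ + X]Rintegral_mkcond.
rewrite -RintegralD//; first by apply: eq_Rintegral => w _; rewrite stageE.
- rewrite -restrict_EFin.
  by apply/integrable_restrict => //; rewrite setTI; exact: intf.
- rewrite -restrict_EFin.
  by apply/integrable_restrict => //; rewrite setTI; exact: intg.
Qed.

Let Z0_ge v Z n w : tail_envelope alpha P X v Z ->
  (`|alpha ^+ n * v (X n w)|%:E <= Z 0%N w)%E.
Proof.
move=> [_ vZ ZS _ _]; rewrite normrM (ger0_norm (exprn_ge0 n (ltW alpha0))).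
by apply: le_trans (vZ n w) _; elim: n => [//|n IH]; exact: le_trans (ZS n w) IH.
Qed.

Let Z0_ge0 v Z w : tail_envelope alpha P X v Z -> (0 <= Z 0%N w)%E.
Proof. by move=> /(Z0_ge 0 w); apply: le_trans. Qed.

Lemma payoff_bound w :
  (`|payoff alpha X f g f tau sigma w|%:E <= Zf 0%N w + Zg 0%N w)%E.
Proof.
have f0 := Z0_ge0 w envf; have g0 := Z0_ge0 w envg.
have fb m : (`|alpha ^+ m * f (X m w)|%:E <= Zf 0%N w + Zg 0%N w)%E.
  by rewrite -[leLHS]adde0; apply: leeD => //; exact: Z0_ge.
have gb k : (`|alpha ^+ k * g (X k w)|%:E <= Zf 0%N w + Zg 0%N w)%E.
  by rewrite -[leLHS]add0e; apply: leeD => //; exact: Z0_ge.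
rewrite /payoff /discounted.
case: (tau w) (sigma w) => [m|] [k|] /=; rewrite ?(inj_eq Some_inj).
- by case: (ltngtP m k) => [_|_|_]; rewrite !(mulr0, mulr1, addr0, add0r).
- by rewrite !(mulr0, mulr1, addr0, add0r).
- by rewrite !(mulr0, mulr1, addr0, add0r).
- by rewrite !(mulr0, mulr1, addr0, add0r) normr0; exact: adde_ge0.
Qed.

(** Dominated convergence: each partial sum is 0 or the payoff, and the payoff
    is bounded by the envelopes of [f] and [g] at time 0. *)
Lemma payoff_expectation_cvg :
  P.-integrable setT (fun w => (payoff alpha X f g f tau sigma w)%:E) /\
  (\sum_(n < N) stage_value n)%:E @[N --> \oo] -->
    ('E_P[payoff alpha X f g f tau sigma])%E.
Proof.
pose F N w := (\sum_(n < N) stage alpha X f g tau sigma n w)%:E.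
have iF N : P.-integrable setT (F N).
  elim: N => [|N IH].
    by apply: eq_integrable (integrable0 P setT) => // w _; rewrite /F big_ord0.
  apply: eq_integrable (integrableD _ IH (stage_integrable N)) => // w _.
  by rewrite /F big_ord_recr.
have FE N : (\int[P]_w F N w)%E = (\sum_(n < N) stage_value n)%:E.
  elim: N => [|N IH].
    by rewrite big_ord0; apply: integral0_eq => w _; rewrite /F big_ord0.
  rewrite big_ord_recr EFinD -IH -stage_integral /Rintegral fineK; last first.
    exact: integrable_fin_num (stage_integrable N).
  rewrite -integralD//; last exact: stage_integrable.
  by apply: eq_integral => w _; rewrite /F big_ord_recr.
have Fcvg w : F N w @[N --> \oo] --> (payoff alpha X f g f tau sigma w)%:E.
  apply: cvg_near_cst.
  case ts : (tau w) => [m|].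
    exists m.+1 => // N /= mN; rewrite /F payoff_partial_sum.
    by rewrite ts /= leqNgt mN.
  case ss : (sigma w) => [k|].
    exists k.+1 => // N /= kN; rewrite /F payoff_partial_sum.
    by rewrite ts ss /= leqNgt kN.
  apply: nearW => N; rewrite /F payoff_partial_sum ts ss /=.
  by rewrite /payoff /discounted ts ss /= !mul0r !addr0.
have iZ v Z : tail_envelope alpha P X v Z -> P.-integrable setT (Z 0%N).
  move=> tZ; have [mZ _ _ Z0oo _] := tZ; apply/integrableP; split=> //.
  by under eq_integral do rewrite (gee0_abs (Z0_ge0 _ tZ)).
have mpay : measurable_fun setT (fun w => (payoff alpha X f g f tau sigma w)%:E).
  apply: (emeasurable_fun_cvg F) => [N|w _]; last exact: Fcvg.
  by have /integrableP[] := iF N.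
have iZfg := integrableD measurableT (iZ f Zf envf) (iZ g Zg envg).
have bound w N : (`|F N w| <= Zf 0%N w + Zg 0%N w)%E.
  rewrite /F payoff_partial_sum; case: ifP => _; last exact: payoff_bound.
  by rewrite abse0; apply: adde_ge0; [exact: Z0_ge0 envf|exact: Z0_ge0 envg].
have [] := @dominated_convergence _ _ _ P setT measurableT F _ _
  (fun N => measurable_int P (iF N)) mpay (aeW P (fun w _ => Fcvg w)) iZfg
  (aeW P (fun w N _ => bound w N)).
move=> ipay _ lim; split=> //; rewrite expectation.unlock.
by under eq_fun do rewrite -FE.
Qed.

Hypotheses (fU : forall y, f y <= U y) (WU : forall y, W y <= U y).

(** The supermartingale inequality, in expectation. *)
Lemma stage_value_le n : stage_value n + alive_value n.+1 <= alive_value n.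
Proof.
have an0 : 0 <= alpha ^+ n by rewrite exprn_ge0// ltW.
rewrite stage_valueE alive_value_split lerD//.
  apply: le_Rintegral => //; [exact: intf|exact: intU|].
  by move=> w _; rewrite ler_wpM2l.
apply: le_Rintegral => //; first exact: intU.
by move=> w _; rewrite ler_wpM2l.
Qed.

Lemma verification_le :
  ('E_P[payoff alpha X f g f tau sigma] <= (U x)%:E)%E.
Proof.
have [_ lim] := payoff_expectation_cvg.
rewrite -(cvg_lim _ lim)//; apply: lime_le; first by apply/cvg_ex; eexists; exact: lim.
apply: nearW => N; rewrite lee_fin -alive_value0.
suff : \sum_(n < N) stage_value n + alive_value N <= alive_value 0.
  by apply: le_trans; rewrite lerDl alive_value_ge0.
elim: N => [|N IH]; first by rewrite big_ord0 add0r.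
rewrite big_ord_recr /= -addrA; apply: le_trans IH.
by rewrite lerD2l stage_value_le.
Qed.

Hypothesis Ulim :
  (\int[P]_w (alpha ^+ n * U (X n w))%:E)%E @[n --> \oo] --> 0%E.
(* The equalities are needed only along the play.  They hold almost surely
   because draws outside (0,1] have probability 0. *)
Hypotheses
  (fU_eq : {ae P, forall w, forall n, tau w = Some n -> f (X n w) = U (X n w)})
  (WU_eq : {ae P, forall w, forall n, not_before (tau w) n.+1 ->
     not_before (sigma w) n -> W (X n w) = U (X n w)}).

Lemma stage_value_eq n : stage_value n + alive_value n.+1 = alive_value n.
Proof.
rewrite stage_valueE alive_value_split; congr (fine _ + fine _).
  apply: ae_eq_integral => //.
  - by have /integrableP[] := intf n (mA n).
  - by have /integrableP[] := intU n (mA n).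
  - apply: filterS fU_eq => w h /andP[/eqP tn _]; by rewrite h.
apply: ae_eq_integral => //.
- by have /integrableP[] := intW n.
- by have /integrableP[] := intU n (mB n).
- by apply: filterS WU_eq => w h /andP[tn sn]; rewrite h.
Qed.

Lemma verification_eq :
  ('E_P[payoff alpha X f g f tau sigma] = (U x)%:E)%E.
Proof.
have [_ lim] := payoff_expectation_cvg.
rewrite -(cvg_lim _ lim)//; apply/cvg_lim => //.
have -> : (fun N => (\sum_(n < N) stage_value n)%:E) =
    (fun N => (U x)%:E - (alive_value N)%:E)%E.
  apply/funext => N; rewrite -EFinB; congr EFin; apply/eqP.
  rewrite eq_sym subr_eq -alive_value0; apply/eqP.
  elim: N => [|N IH]; first by rewrite big_ord0 add0r.
  by rewrite IH big_ord_recr /= -addrA stage_value_eq.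
rewrite -[X in _ --> X]sube0; apply: cvgeB => //; first exact: cvg_cst.
exact: alive_value_cvg.
Qed.

End verification.
(** * Best responses and the stopping value *)

Section uniform_draws.
Context {R : realType} {dO : measure_display} {Omega : measurableType dO}.

(** Almost surely a level 0 never stops the play and a level 1 always does. *)
Lemma uniform_draws_ae (P : probability Omega R) (xi : nat -> Omega -> R) :
  iid_uniform P xi -> {ae P, forall w, forall n, 0 < xi n w <= 1}.
Proof.
move=> [mxi law _]; have mle (c : R) : measurable [set y : R | y <= c].
  have -> : [set y | y <= c] = `]-oo, c]%classic :> set R.
    by apply/seteqP; split=> y /=; rewrite in_itv.
  exact: measurable_itv.
have mpre n c : measurable (xi n @^-1` [set y | y <= c]).
  by rewrite -[X in measurable X]setTI; exact: mxi.
have Ple n c : 0 <= c <= 1 -> P (xi n @^-1` [set y | y <= c]) = c%:E.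
  by move=> c01; rewrite law// uniform_prob_le.
apply: ae_foralln => n.
exists (xi n @^-1` [set y | y <= 0] `|` ~` (xi n @^-1` [set y | y <= 1])); split.
- by apply: measurableU => //; exact: measurableC.
- have mC := measurableC (mpre n 1).
  apply: (null_set_setU (mpre n 0) mC); first by apply: Ple; rewrite lexx ler01.
  have e1 : P (xi n @^-1` [set y | y <= 1]) = 1%:E by apply: Ple; rewrite lexx ler01.
  by have := probability_setC P (mpre n 1); rewrite e1 subee.
- move=> w /= nh; have [x0|x0] := leP (xi n w) 0; [by left|right].
  by move=> x1; apply: nh; rewrite x0 x1.
Qed.

End uniform_draws.

Section markov_times_stop.
Context {R : realType} {dE : measure_display} {E : measurableType dE}
        {dO : measure_display} {Omega : measurableType dO}.

Lemma markov_time_stopping (X : nat -> Omega -> E) (xi : nat -> Omega -> R)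
    (p : E -> R) : measurable_fun setT p ->
  stopping_time (player_filtration X xi) (markov_time X xi p).
Proof.
move=> mp n.
pose G := \bigcup_(k in `I_n.+1)
  (preimage_set_system setT (X k) measurable `|`
   preimage_set_system setT (xi k) measurable).
have -> : [set w | time_le (markov_time X xi p w) n] =
    ~` [set w | not_before (markov_time X xi p w) n.+1].
  by apply/seteqP; split=> w /=; rewrite not_beforeS; [move=> ->|move/negP; rewrite negbK].
apply: (@measurableC _ (g_sigma_algebraType G)).
apply: not_before_markov_time_measurable => // k kn _ B mB; rewrite setTI;
  apply: sub_sigma_algebra; exists k => //.
- by left; exists B; rewrite ?setTI.
- by right; exists B; rewrite ?setTI.
Qed.

Lemma measurable_discounted (alpha : R) (X : nat -> Omega -> E) (f : E -> R)
    (tau : Omega -> option nat) :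
  measurable_fun setT f -> (forall n, measurable_fun setT (X n)) ->
  (forall n, measurable [set w | tau w = Some n]) ->
  measurable_fun setT (discounted alpha X f tau).
Proof.
move=> mf mX mtau _ B mB; rewrite setTI.
have -> : discounted alpha X f tau @^-1` B =
    (\bigcup_n ([set w | tau w = Some n] `&`
       (fun w => alpha ^+ n * f (X n w)) @^-1` B)) `|`
    ((\bigcap_n ~` [set w | tau w = Some n]) `&` [set w | B 0]).
  apply/seteqP; split=> w; rewrite /discounted /=.
    case tw : (tau w) => [n|] Bw; first by left; exists n.
    by right; split=> // n _ /=; rewrite tw.
  move=> [[n _ [/= -> //]]|[nt B0]].
  by case tw : (tau w) => [n|//]; have := nt n Logic.I; rewrite /= tw.
apply: measurableU.
  apply: bigcupT_measurable => n; apply: measurableI => //.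
  rewrite -[X in measurable X]setTI.
  suff mn : measurable_fun setT (fun w => alpha ^+ n * f (X n w)) by exact: mn.
  by apply: measurable_funM => //; exact: measurableT_comp.
apply: measurableI; first by apply: bigcapT_measurable => n; exact: measurableC.
have [B0|nB0] := pselect (B 0).
- by rewrite (_ : [set w | _] = setT)//; apply/seteqP; split.
- by rewrite (_ : [set w | _] = set0)//; apply/seteqP; split.
Qed.

End markov_times_stop.
Section best_responses.
Context {R : realType} {dE : measure_display} {E : measurableType dE}
        {dO : measure_display} {Omega : measurableType dO}.
Variables (Pi : R.-pker E ~> E) (alpha : R).
Hypotheses (alpha0 : 0 < alpha).
Variables (P : E -> probability Omega R) (X : nat -> Omega -> E)
          (xa xb : nat -> Omega -> R).
Hypothesis mkv : forall x, markov_process Pi (P x) X x.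
Hypothesis iida : forall x, iid_uniform (P x) xa.
Hypothesis iidb : forall x, iid_uniform (P x) xb.
Hypothesis indep : forall x A1 A2 A3,
  sigma_of setT X A1 -> sigma_of setT xa A2 -> sigma_of setT xb A3 ->
  (P x (A1 `&` A2 `&` A3) = P x A1 * P x A2 * P x A3)%E.
Variables (f g U : E -> R).
Hypotheses (mf : measurable_fun setT f) (mg : measurable_fun setT g).
Hypothesis envf : forall x, exists Z, tail_envelope alpha (P x) X f Z.
Hypothesis envg : forall x, exists Z, tail_envelope alpha (P x) X g Z.
Hypothesis solU : bellman_solution Pi alpha P X f U.

Local Notation continue p y :=
  (p y * g y + (1 - p y) * (alpha * kernel_op Pi U y)).

Let fU y : f y <= U y.
Proof. by case: solU => _ _ -> _ _; rewrite le_max lexx. Qed.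

(** No deviation is profitable if the lottery offered by the opponent is nowhere
    worth more than [U]. *)
Lemma response_le (p : E -> R) x tau :
  measurable_fun setT p -> (forall y, 0 <= p y <= 1) ->
  (forall y, continue p y <= U y) ->
  stopping_time (player_filtration X xa) tau ->
  ('E_(P x)[payoff alpha X f g f tau (markov_time X xb p)] <= (U x)%:E)%E.
Proof.
move=> mp p01 cU stau; have [mU U0 _ PiU trans] := solU.
have [Ufin _] := trans x; have [ma _ _] := iida x.
have [Zf tZf] := envf x; have [Zg tZg] := envg x.
exact: (verification_le alpha0 (mkv x) ma (iidb x) (@indep x) mp p01 mU U0 PiU
  Ufin mf mg tZf tZg stau fU cU).
Qed.

(** Whatever the Markovian player does with positive probability is optimal in
    the one-step game, so nothing is lost at any stage. *)
Lemma response_eq (pa pb : E -> R) x :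
  measurable_fun setT pa -> measurable_fun setT pb ->
  (forall y, 0 <= pb y <= 1) ->
  (forall y, 0 < pa y -> f y = U y) ->
  (forall y, pa y < 1 -> continue pb y = U y) ->
  ('E_(P x)[payoff alpha X f g f (markov_time X xa pa) (markov_time X xb pb)] =
    (U x)%:E)%E.
Proof.
move=> ma mb pb01 stop cont; have [mU U0 _ PiU trans] := solU.
have [Ufin Ulim] := trans x; have [mxa _ _] := iida x.
have [Zf tZf] := envf x; have [Zg tZg] := envg x.
have stop_ae : {ae P x, forall w, forall n,
    markov_time X xa pa w = Some n -> f (X n w) = U (X n w)}.
  apply: filterS (uniform_draws_ae (iida x)) => w draws n tn.
  apply: stop; have /andP[x0 _] := draws n; apply: lt_le_trans x0 _.
  have nb : not_before (markov_time X xa pa w) n by rewrite tn /=.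
  by rewrite -(markov_time_now nb) tn.
have cont_ae : {ae P x, forall w, forall n,
    not_before (markov_time X xa pa w) n.+1 ->
    not_before (markov_time X xb pb w) n -> continue pb (X n w) = U (X n w)}.
  apply: filterS (uniform_draws_ae (iida x)) => w draws n nb _.
  apply: cont; have /andP[_ x1] := draws n; apply: lt_le_trans x1.
  by move/not_before_markov_time: nb; apply.
exact: (verification_eq alpha0 (mkv x) mxa (iidb x) (@indep x) mb pb01 mU U0 PiU
  Ufin mf mg tZf tZg (@markov_time_stopping _ _ _ _ _ X xa pa ma) Ulim stop_ae cont_ae).
Qed.

End best_responses.

Section stopping_value_solution.
Context {R : realType} {dE : measure_display} {E : measurableType dE}
        {dO : measure_display} {Omega : measurableType dO}.
Variables (Pi : R.-pker E ~> E) (alpha : R).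
Hypotheses (alpha0 : 0 < alpha) (alpha1 : alpha < 1).
Variables (P : E -> probability Omega R) (X : nat -> Omega -> E)
          (xi1 xi2 : nat -> Omega -> R) (T : Omega -> nat).
Hypothesis setting : game_setting Pi alpha P X xi1 xi2 T.
Variable f : E -> R.
Hypotheses (mf : measurable_fun setT f) (intf : sup_killed_integrable P X T f).

Lemma stopping_time_measurable (x : E) tau n :
  stopping_time (player_filtration X xi1) tau ->
  measurable [set w | tau w = Some n].
Proof.
move=> stau; have [mk [m1 _ _] u2 _ _] := setting x.
have [mX _ _] := mk; have [m2 _ _] := u2.
have mle m : measurable [set w | time_le (tau w) m].
  apply: (gsigma_sub (past_measurable mX m1 m2)).
  exact: (player_filtration_past (xb := xi2) (stau m)).
have mnb m : measurable [set w | not_before (tau w) m].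
  case: m => [|m].
    rewrite (_ : [set w | _] = setT)//.
    by apply/seteqP; split=> // w _ /=; case: (tau w).
  rewrite (_ : [set w | _] = ~` [set w | time_le (tau w) m]).
    exact: measurableC.
  by apply/seteqP; split=> w /=; rewrite not_beforeS => /negP.
rewrite (_ : [set w | _] = [set w | not_before (tau w) n] `\`
    [set w | not_before (tau w) n.+1]).
  exact: measurableD.
apply/seteqP; split=> w /=; first by move=> -> /=; rewrite leqnn ltnn.
by rewrite not_before_split => -[/orP[/eqP //|h] /(_ h)].
Qed.

Let never (y : E) : R := 0.

(** Draws are almost surely positive, so that an opponent with level 0 stays
    forever, and the game reduces to a stopping problem. *)
Lemma never_stopping_payoff x tau :
  stopping_time (player_filtration X xi1) tau ->
  ('E_(P x)[payoff alpha X f f f tau (markov_time X xi2 never)] =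
   'E_(P x)[discounted alpha X f tau])%E.
Proof.
move=> stau; have [mk u1 u2 _ _] := setting x.
have [mX _ _] := mk; have [m1 _ _] := u1.
have mtau n := @stopping_time_measurable x tau n stau.
have [Z tZ] := tail_envelope_exists alpha0 alpha1 setting x mf intf.
have mn : measurable_fun setT never by exact: measurable_cst.
have [/integrableP[mpay _] _] :=
  payoff_expectation_cvg alpha0 mk m1 u2 mn mf mf tZ tZ stau.
rewrite expectation.unlock; apply: ae_eq_integral => //.
  by apply/measurable_EFinP; exact: measurable_discounted.
apply: filterS (uniform_draws_ae u2) => w draws _; congr EFin.
rewrite /payoff /discounted (_ : markov_time X xi2 never w = None).
  by case: (tau w) => [n|] /=; rewrite !(mulr0, mulr1, mul0r, addr0, add0r).
rewrite /markov_time; case: pselect => // -[n xn]; exfalso.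
by have /andP[] := draws n; rewrite ltNge xn.
Qed.

(** The verification argument against an opponent with level 0, whose lottery is
    worth alpha Pi U <= U.  The optimal player stops where [U = f]; elsewhere
    the optimality equation gives [U = alpha Pi U]. *)
Lemma stopping_value_bellman U : bellman_solution Pi alpha P X f U ->
  stopping_value alpha P X xi1 f = U.
Proof.
move=> solU; have [mU U0 UE _ _] := solU.
have mkv x : markov_process Pi (P x) X x by have [] := setting x.
have u1 x : iid_uniform (P x) xi1 by have [] := setting x.
have u2 x : iid_uniform (P x) xi2 by have [] := setting x.
have ind := setting_indep setting.
have env x := tail_envelope_exists alpha0 alpha1 setting x mf intf.
have mn : measurable_fun setT never by exact: measurable_cst.
have n01 y : 0 <= never y <= 1 by rewrite lexx ler01.
have neverE y : never y * f y + (1 - never y) * (alpha * kernel_op Pi U y) =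
    alpha * kernel_op Pi U y.
  by rewrite mul0r add0r subr0 mul1r.
have neverU y :
    never y * f y + (1 - never y) * (alpha * kernel_op Pi U y) <= U y.
  by rewrite neverE [leRHS]UE le_max lexx orbT.
pose stop y : R := if U y <= f y then 1 else 0.
have mstop : measurable_fun setT stop.
  by apply: measurable_fun_ifT => //; exact: measurable_fun_ler.
have stop_pos y : 0 < stop y -> f y = U y.
  rewrite /stop; case: ifP => [Uf _|_]; last by rewrite ltxx.
  by apply/eqP; rewrite eq_le Uf [leRHS]UE le_max lexx.
have stop_lt1 y : stop y < 1 ->
    never y * f y + (1 - never y) * (alpha * kernel_op Pi U y) = U y.
  rewrite neverE /stop; case: ifP => [_|/negbT]; first by rewrite ltxx.
  rewrite -ltNge => fU _; move: (UE y); rewrite /Num.max; case: ifP => // _ e.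
  by rewrite e ltxx in fU.
apply/funext => x; rewrite /stopping_value.
suff -> : ereal_sup [set ('E_(P x)[discounted alpha X f tau])%E |
    tau in stopping_time (player_filtration X xi1)] = (U x)%:E by [].
apply/eqP; rewrite eq_le; apply/andP; split.
  apply: ge_ereal_sup => _ [tau stau <-].
  rewrite -never_stopping_payoff//.
  exact: (response_le alpha0 mkv u1 u2 ind mf mf env env solU x mn n01 neverU stau).
apply: ereal_sup_ubound; exists (markov_time X xi1 stop).
  exact: markov_time_stopping.
rewrite -never_stopping_payoff; last exact: markov_time_stopping.
exact: (response_eq alpha0 mkv u1 u2 ind mf mf env env solU x mstop mn n01 stop_pos stop_lt1).
Qed.

End stopping_value_solution.
(** * The symmetric equilibrium *)

Theorem theorem6p1 (R : realType)
    (dE : measure_display) (E : measurableType dE)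
    (dO : measure_display) (Omega : measurableType dO)
    (Pi : R.-pker E ~> E) (alpha : R) (alpha_gt0 : 0 < alpha)
    (alpha_lt1 : alpha < 1)
    (P : E -> probability Omega R) (X : nat -> Omega -> E)
    (xi1 xi2 : nat -> Omega -> R) (T : Omega -> nat)
    (setting : game_setting Pi alpha P X xi1 xi2 T)
    (f g h : E -> R)
    (mf : measurable_fun setT f) (mg : measurable_fun setT g)
    (mh : measurable_fun setT h)
    (intf : sup_killed_integrable P X T f)
    (intg : sup_killed_integrable P X T g)
    (inth : sup_killed_integrable P X T h)
    (fh : f = h) :
  let V := stopping_value alpha P X xi1 f in
  let aPV x := alpha * kernel_op Pi V x in
  forall (p : E -> R) (mp : measurable_fun setT p)
    (p01 : forall x, 0 <= p x <= 1)
    (p_i : forall x, aPV x = f x -> g x = f x -> 0 <= p x <= 1)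
    (p_ii : forall x, aPV x = f x -> g x <> f x -> p x = 0)
    (p_iii : forall x, aPV x < f x -> g x > f x ->
       p x = (f x - aPV x) / (g x - aPV x))
    (p_iv : forall x, aPV x < f x -> g x <= f x -> p x = 1)
    (p_v : forall x, aPV x > f x -> p x = 0),
  global_markov_equilibrium alpha P X xi1 xi2 f g h p p /\
  (forall x,
     J1 alpha P X f g h x (markov_time X xi1 p) (markov_time X xi2 p)
       = (V x)%:E /\
     J2 alpha P X f g h x (markov_time X xi1 p) (markov_time X xi2 p)
       = (V x)%:E).
Proof.
move=> V aPV p mp p01 _ p_ii p_iii p_iv p_v; subst h.
have [U solU] := bellman_solution_exists alpha_gt0 alpha_lt1 setting mf intf.
have VU : V = U by exact: (stopping_value_bellman alpha_gt0 alpha_lt1 setting mf intf solU).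
have [_ _ UE _ _] := solU.
have aE y : alpha * kernel_op Pi U y = aPV y by rewrite /aPV VU.
have {}UE y : U y = Num.max (f y) (aPV y) by rewrite UE aE.
(* Only in case (v) does f differ from U, and there p = 0. *)
have stop y : 0 < p y -> f y = U y.
  rewrite UE; case: (ltgtP (f y) (aPV y)) => [fa|//|//].
  by rewrite p_v// ltxx.
(* In case (iii), p is the root of p g + (1 - p) alpha Pi V = f; in case (i)
   all three payoffs are equal, and in cases (ii) and (v) p = 0 while
   alpha Pi V = U. *)
have cont y : p y < 1 -> p y * g y + (1 - p y) * (alpha * kernel_op Pi U y) = U y.
  rewrite aE UE; case: (ltgtP (f y) (aPV y)) => [fa|af|fa] p1.
  - by rewrite p_v// mul0r add0r subr0 mul1r.
  - have [gf|fg] := leP (g y) (f y); first by rewrite p_iv// ltxx in p1.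
    have ga : g y - aPV y != 0 by rewrite gt_eqF// subr_gt0 (lt_trans af).
    by rewrite p_iii//; field.
  - have [gf|/eqP gf] := eqVneq (g y) (f y).
      by rewrite -fa gf; ring.
    by rewrite p_ii// mul0r add0r subr0 mul1r.
(* Where p = 1 the lottery pays g, and g <= f: in case (iii) p = 1 would force
   g = f. *)
have cont_le y : p y * g y + (1 - p y) * (alpha * kernel_op Pi U y) <= U y.
  have /andP[_] := p01 y; rewrite le_eqVlt => /predU1P[p1|/cont -> //].
  rewrite p1 mul1r subrr mul0r addr0 -stop; last by rewrite p1.
  case: (ltgtP (aPV y) (f y)) => [af|fa|fa].
  - have [//|fg] := leP (g y) (f y).
    have ga : g y - aPV y != 0 by rewrite gt_eqF// subr_gt0 (lt_trans af).
    have : p y * (g y - aPV y) = f y - aPV y by rewrite p_iii// divfK.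
    by rewrite p1 mul1r; lra.
  - by have := p_v y fa; rewrite p1 => /eqP; rewrite oner_eq0.
  - have [->//|/eqP gf] := eqVneq (g y) (f y).
    by have := p_ii y fa gf; rewrite p1 => /eqP; rewrite oner_eq0.
have mkv x : markov_process Pi (P x) X x by have [] := setting x.
have u1 x : iid_uniform (P x) xi1 by have [] := setting x.
have u2 x : iid_uniform (P x) xi2 by have [] := setting x.
have ind12 := setting_indep setting.
have ind21 x A1 A2 A3 : sigma_of setT X A1 -> sigma_of setT xi2 A2 ->
    sigma_of setT xi1 A3 ->
    (P x (A1 `&` A2 `&` A3) = P x A1 * P x A2 * P x A3)%E.
  by move=> s1 s2 s3; rewrite setIAC ind12// muleAC.
have envf x := tail_envelope_exists alpha_gt0 alpha_lt1 setting x mf intf.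
have envg x := tail_envelope_exists alpha_gt0 alpha_lt1 setting x mg intg.
have J1E x : J1 alpha P X f g f x (markov_time X xi1 p) (markov_time X xi2 p) =
    (U x)%:E.
  exact: (response_eq alpha_gt0 mkv u1 u2 ind12 mf mg envf envg solU).
have J2E x : J2 alpha P X f g f x (markov_time X xi1 p) (markov_time X xi2 p) =
    (U x)%:E.
  exact: (response_eq alpha_gt0 mkv u2 u1 ind21 mf mg envf envg solU).
split; last by move=> x; rewrite VU.
move=> x; split; apply/eqP; rewrite eq_le; apply/andP; split.
- apply: ereal_sup_ubound; exists (markov_time X xi1 p) => //.
  exact: markov_time_stopping.
- apply: ge_ereal_sup => _ [tau stau <-]; rewrite J1E.
  exact: (response_le alpha_gt0 mkv u1 u2 ind12 mf mg envf envg solU x mp p01 cont_le stau).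
- apply: ereal_sup_ubound; exists (markov_time X xi2 p) => //.
  exact: markov_time_stopping.
- apply: ge_ereal_sup => _ [tau stau <-]; rewrite J2E.
  exact: (response_le alpha_gt0 mkv u2 u1 ind21 mf mg envf envg solU x mp p01 cont_le stau).
Qed.
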